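(* Given any subclass of finitely many instances $\mathcal{I}\subset\mathcal{I}_{n,d,R,\rho,M}$ and any first-order chart $\mathcal{G}$, there exists a query strategy for this subclass using the general binary oracle based on $\mathcal{G}$ that reports an $\epsilon$-approximate solution by making at most $$O\left(\log|\mathcal{I}|+2^n\,d\,(n+d)\log\left(\frac{dMR}{\min\{\rho,1\}\,\epsilon}\right)\right)$$ queries. In the (pure continuous) case of $n=0$, $O\left(\log|\mathcal{I}|+d\log\left(\frac{MR}{\min\{\rho,1\}\,\epsilon}\right)\right)$ queries suffice.
   Context: **Problem.** A mixed-integer convex optimization instance $(f,C)$ is $\inf\{f(\mathbf{x},\mathbf{y}): (\mathbf{x},\mathbf{y})\in C\cap(\mathbb{Z}^n\times\mathbb{R}^d)\}$, with $f:\mathbb{R}^n\times\mathbb{R}^d\to\mathbb{R}$ convex and $C\subseteq\mathbb{R}^n\times\mathbb{R}^d$ closed and convex. A feasible solution is a point of $C\cap(\mathbb{Z}^n\times\mathbb{R}^d)$. An $\epsilon$-approximate solution is a feasible $(\mathbf{x},\mathbf{y})$ with $f(\mathbf{x},\mathbf{y})\le f(\mathbf{x}',\mathbf{y}')+\epsilon$ for all feasible $(\mathbf{x}',\mathbf{y}')$. **Class $\mathcal{I}_{n,d,R,\rho,M}$.** All instances such that: (i) $C\subseteq\{\mathbf{z}:\|\mathbf{z}\|_\infty\le R\}$; (ii) if $(\mathbf{x}^\star,\mathbf{y}^\star)$ is an optimal solution, there is $\hat{\mathbf{y}}\in\mathbb{R}^d$ with $\{(\mathbf{x}^\star,\mathbf{y}):\|\mathbf{y}-\hat{\mathbf{y}}\|_\infty\le\rho\}\subseteq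 C$; (iii) for every $\mathbf{x}\in[-R,R]^n\cap\mathbb{Z}^n$, $f$ is Lipschitz with respect to $\|\cdot\|_\infty$ with constant $M$ on $\{\mathbf{x}\}\times[-R,R]^d$. **Query strategies.** An oracle for a class of instances is a family $\mathcal{Q}$ of queries, each a function from instances to a response set $H$. A query strategy is a function $D:(\mathcal{Q}\times H)^*\to\mathcal{Q}$ choosing the next query from the sequence of previous query-response pairs. It reports an $\epsilon$-approximate solution with $k$ queries if, for every instance in the class, an $\epsilon$-approximate solution can be output based on the first $k$ query-response pairs (equivalently, all instances in the class consistent with those responses have a common $\epsilon$-approximate solution). The query strategy may depend on the (known) chart $\mathcal{G}$ and on the (known) finite class $\mathcal{I}$. **First-order charts and oracles $\mathcal{O}(\mathcal{G},\mathcal{H})$.** A first-order chart $\mathcal{G}$ consists, for every $\mathbf{z}\in[-R,R]^{n+d}$, of maps on instances: $\mathbf{g}^{\mathrm{sep}}_{\mathbf{z}}(f,C)\in\mathbb{R}^{n+d}$, equal to $\mathbf{0}$ if $\mathbf{z}\in C$ and otherwise a norm-1 vector with $C\subseteq\{\mathbf{z}':\langle\mathbf{g}^{\mathrm{sep}}_{\mathbf{z}}(f,C),\mathbf{z}'\rangle<\langle\mathbf{g}^{\mathrm{sep}}_{\mathbf{z}}(f,C),\mathbf{z}\rangle\}$; $\mathbf{g}^{\mathrm{val}}_{\mathbf{z}}(f,C)=f(\mathbf{z})$; and $\mathbf{g}^{\mathrm{sub}}_{\mathbf{z}}(f,C)\in\partial f(\mathbf{z})$. Queries of $\mathcal{O}(\mathcal{G},\mathcal{H})$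 are pairs $(\mathbf{z},h)$ with $h\in\mathcal{H}=\mathcal{H}^{\mathrm{sep}}\cup\mathcal{H}^{\mathrm{val}}\cup\mathcal{H}^{\mathrm{sub}}$; the response is $h$ applied to $\mathbf{g}^{\mathrm{sep}}_{\mathbf{z}}$, $\mathbf{g}^{\mathrm{val}}_{\mathbf{z}}$ or $\mathbf{g}^{\mathrm{sub}}_{\mathbf{z}}$ of the unknown instance, respectively. In the general binary oracle based on $\mathcal{G}$, $\mathcal{H}$ consists of all $\{0,1\}$-valued functions on $\mathbb{R}^{n+d}$ (separating hyperplanes), on $\mathbb{R}$ (function values) and on $\mathbb{R}^{n+d}$ (subgradients). $O(\cdot)$ hides an absolute constant factor.
   Formalization: Assumes d ≥ 1, R, ρ, ε > 0, every instance feasible, ε ≤ M, and the logarithm's argument at least 2; as printed the bound is undefined or fails when d = 0, when M is far below ε, or when the logarithm is near 0. *)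

(* Defs.v *)
From mathcomp Require Import all_boot all_order all_algebra.
From mathcomp Require Import all_classical all_reals all_analysis.

Set Implicit Arguments.
Unset Strict Implicit.
Unset Printing Implicit Defensive.

Import Order.TTheory GRing.Theory Num.Theory.
Import numFieldNormedType.Exports.

Local Open Scope classical_set_scope.
Local Open Scope ring_scope.

(* R^n x R^d is represented by 'rV[K]_(n + d), the point (x, y) being
   [row_mx x y]; K is the field of real numbers. On row vectors `|z| is the
   library's matrix norm, i.e. the sup norm. *)

Section Problem.
Variables (K : realType) (n d : nat).

Record instance := Instance {
  obj : 'rV[K]_(n + d) -> K;
  cset : set 'rV[K]_(n + d) }.

Definition integral (x : 'rV[K]_n) : Prop := x \is a mxOver Num.int.

Definition feasible (i : instance) (z : 'rV[K]_(n + d)) : Prop :=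
  cset i z /\ integral (lsubmx z).

Definition approx_solution (eps : K) (i : instance) (z : 'rV[K]_(n + d)) :
    Prop :=
  feasible i z /\ forall z', feasible i z' -> obj i z <= obj i z' + eps.

Definition optimal (i : instance) (z : 'rV[K]_(n + d)) : Prop :=
  feasible i z /\ forall z', feasible i z' -> obj i z <= obj i z'.

Definition box (R : K) : set 'rV[K]_(n + d) := [set z | `|z| <= R].

Definition instance_class (R rho M : K) : set instance := [set i |
  [/\ convex_function setT (obj i), closed (cset i) & convex_set (cset i)] /\
  [/\ cset i `<=` box R,
      forall (xs : 'rV[K]_n) (ys : 'rV[K]_d), optimal i (row_mx xs ys) ->
        exists yhat : 'rV[K]_d, forall y : 'rV[K]_d,
          `|y - yhat| <= rho -> cset i (row_mx xs y)
    & forall x : 'rV[K]_n, integral x -> `|x| <= R ->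
        M.-lipschitz_[set y : 'rV[K]_d | `|y| <= R]
          (fun y => obj i (row_mx x y))]].

End Problem.

Section Oracles.
Variable inst : Type.

(* A query is identified with the map from instances to responses it denotes. *)
Definition query (H : Type) := inst -> H.

Definition oracle (H : Type) := set (query H).

(* The empty sequence gives the first query; later query-response pairs are
   appended at the end. *)
Definition history (H : Type) := seq (query H * H).

Definition query_strategy (H : Type) (Q : oracle H)
    (D : history H -> query H) : Prop :=
  forall s, Q (D s).

Fixpoint transcript (H : Type) (D : history H -> query H) (i : inst)
    (k : nat) : history H :=
  if k is k'.+1 then
    let s := transcript D i k' in rcons s (D s, D s i)
  else [::].

(* The output is a function of the first k query-response pairs only;
   [sol i] is the set of acceptable outputs for the instance i. *)
Definition reports (H S : Type) (I : set inst) (sol : inst -> set S)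
    (D : history H -> query H) (k : nat) : Prop :=
  exists out : history H -> S, forall i, I i -> sol i (out (transcript D i k)).

End Oracles.

Section FirstOrder.
Variables (K : realType) (n d : nat).

Definition dot (m : nat) (u v : 'rV[K]_m) : K := \sum_(j < m) u 0 j * v 0 j.

Definition l2norm (m : nat) (u : 'rV[K]_m) : K := Num.sqrt (dot u u).

Definition subdifferential (m : nat) (f : 'rV[K]_m -> K) (z : 'rV[K]_m) :
    set 'rV[K]_m :=
  [set g | forall z', f z + dot g (z' - z) <= f z'].

Record chart := Chart {
  gsep : 'rV[K]_(n + d) -> instance K n d -> 'rV[K]_(n + d);
  gval : 'rV[K]_(n + d) -> instance K n d -> K;
  gsub : 'rV[K]_(n + d) -> instance K n d -> 'rV[K]_(n + d) }.

(* The maps of a chart are total functions, but they are only constrained (and,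
   in the oracle below, only used) at points of the box [-R, R]^(n+d). *)
Definition first_order_chart (R : K) (A : set (instance K n d)) (G : chart) :
    Prop :=
  forall z i, box R z -> A i ->
    [/\ cset i z -> gsep G z i = 0,
        ~ cset i z -> l2norm (gsep G z i) = 1 /\
          cset i `<=` [set z' | dot (gsep G z i) z' < dot (gsep G z i) z],
        gval G z i = obj i z
      & subdifferential (obj i) z (gsub G z i)].

Definition first_order_oracle (H : Type) (R : K) (G : chart)
    (Hsep : set ('rV[K]_(n + d) -> H)) (Hval : set (K -> H))
    (Hsub : set ('rV[K]_(n + d) -> H)) : oracle (instance K n d) H :=
  [set q | exists2 z, box R z &
    [\/ exists2 h, Hsep h & q = (fun i => h (gsep G z i)),
        exists2 h, Hval h & q = (fun i => h (gval G z i))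
      | exists2 h, Hsub h & q = (fun i => h (gsub G z i))]].

Definition general_binary_oracle (R : K) (G : chart) :
    oracle (instance K n d) bool :=
  first_order_oracle R G setT setT setT.

End FirstOrder.

(* Main.v *)
(** All instances share the following localization scheme: a finite grid of
candidate points carries, for every instance, many eps-approximate solutions
near its optimum; querying a point z that is deep in the set of surviving grid
points yields a halfspace (separating or subgradient) that deletes a constant
fraction alpha of them, and once so few survive that some eps-approximate grid
point was deleted, the best feasible query point is eps-approximate.  A full
response costs one binary query each up to an extra O(log |I|) in total: if some
value is taken by at least a third of the surviving instances we ask for it, and
otherwise the values split into two balanced halves, so that every query either
reveals the response or discards a constant fraction of the instances.

A deep point with 1 / alpha = 2^n (d+1) exists by a Doignon-type Helly theorem:
Helly in the fibers R^d reduces the problem to halfspaces of R^n not containing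
a given lattice point, and Scarf's relaxation argument shows that some 2^n of
those already miss the whole lattice box.  For n = 0 the centroid is deep with
alpha = 1/10 (Gruenbaum): on a sufficiently fine grid the counting measure is
log-concave up to an error term, by a discrete Prekopa-Leindler inequality. *)

Require Import Defs.
From mathcomp Require Import all_boot all_order all_algebra.
From mathcomp Require Import all_classical all_reals all_analysis.
(* Re-imported: the finset names must shadow those of classical_sets. *)
From mathcomp Require Import fintype finset.
From mathcomp Require Import ring lra zify.

Set Implicit Arguments.
Unset Strict Implicit.
Unset Printing Implicit Defensive.

Import Order.TTheory GRing.Theory Num.Theory.
Import numFieldNormedType.Exports.

Local Open Scope ring_scope.

(** One potential, the number of surviving grid points, drives both bounds, but the stopping sizes
    differ. For mixed instances it is enough that each target contains one grid point, so the cost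
    is governed by the logarithm of the whole grid, which is just fine enough to hit every target
    ball. For n = 0 the rounding errors call for a far finer grid, whose logarithm could not be
    afforded; but each target then holds a fixed fraction of the grid, and only the ratio of grid to
    target enters the number of cuts. The fineness can therefore be chosen after the number of cuts,
    on which the rounding error depends.

    In both cases the query point must be common to all surviving instances. It depends only on the
    surviving grid points, hence only on earlier responses, which is why a response is learned
    completely before the next cut. *)

(** * Discrete Brunn-Minkowski and Gruenbaum inequalities *)

(* [b |-> min A + b] and [a |-> a + max B + 1] inject A and B into disjoint sets
   of sums, and halving is at most two-to-one. *)
Lemma leq_card_midset (L : nat) (A B C : {set 'I_L}) :
  A != set0 -> B != set0 ->
  (forall (a b c : 'I_L) (e : bool), a \in A -> b \in B ->
     c = (a + b + e)./2 :> nat -> c \in C) ->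
  (#|A| + #|B| <= #|C| * 2)%N.
Proof.
move=> /set0Pn[a0 a0A] /set0Pn[b0 b0B] midC.
have [a aA amin] := arg_minnP (fun i : 'I_L => i : nat) a0A.
have [b bB bmax] := arg_maxnP (fun i : 'I_L => i : nat) b0B.
pose s := [seq (x + b).+1 | x : 'I_L <- enum A] ++ [seq (a + y)%N | y : 'I_L <- enum B].
pose t := [seq ((c : 'I_L).*2 + e)%N | c <- enum C, e <- [:: 0; 1]%N].
have -> : (#|A| + #|B|)%N = size s by rewrite size_cat !size_map -!cardE.
have -> : (#|C| * 2)%N = size t by rewrite size_allpairs -cardE.
apply: uniq_leq_size.
  rewrite cat_uniq !map_inj_uniq ?enum_uniq ?andbT /=; last 2 first.
  - by move=> x y /= h; apply: val_inj => /=; lia.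
  - by move=> x y /= h; apply: val_inj => /=; lia.
  apply/hasPn => _ /mapP[y yB ->]; apply/mapP => -[x xA].
  rewrite !mem_enum in yB xA.
  by move: (amin _ xA) (bmax _ yB) => /= h1 h2 h3; have := leq_add h1 h2; rewrite h3 ltnn.
have key (x y : 'I_L) (e : bool) : x \in A -> y \in B -> (x + y + e)%N \in t.
  move=> xA yB; have lt : ((x + y + e)./2 < L)%N.
    by have := ltn_ord x; have := ltn_ord y; case: e => /=; lia.
  apply/allpairsP; exists (Ordinal lt, (odd (x + y + e) : nat)); split => /=.
  - by rewrite mem_enum; apply: midC xA yB _.
  - by rewrite !inE; case: odd.
  - by rewrite -[LHS](odd_double_half (x + y + e)) addnC.
move=> z; rewrite mem_cat => /orP[] /mapP[x]; rewrite mem_enum => xS ->.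
  by have := key _ _ true xS bB; rewrite /= addn1.
by have := key _ _ false aA xS; rewrite /= addn0.
Qed.

Section Prekopa.
Variables (K : rcfType) (L : nat).
Implicit Types f g h : 'I_L -> K.

(* Induction on the supports: the smallest positive value v of f and g is
   subtracted from f, g and h, which removes one layer of each. *)
Lemma sum_midpoint_min f g h (M : K) :
  (forall i, 0 <= f i) -> (forall i, 0 <= g i) -> (forall i, 0 <= h i) ->
  (forall i, f i <= M) -> (forall i, g i <= M) ->
  (exists i, f i = M) -> (exists i, g i = M) ->
  (forall (a b c : 'I_L) (e : bool), c = (a + b + e)./2 :> nat ->
     Num.min (f a) (g b) <= h c) ->
  \sum_i f i + \sum_i g i <= 2 * \sum_i h i.
Proof.
have [n] := ubnP (#|[set i | (0 < f i)%R]| + #|[set i | (0 < g i)%R]|)%N.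
elim: n f g h M => // n IH f g h M ltn f0 g0 h0 fM gM [i fi] [j gj] hmin.
(* The common maximum M makes both supports nonempty once M > 0, as the comparison of layers
   requires; it survives the subtraction as M - v. *)
have [M0|M0] := leP M 0.
  have -> : \sum_i f i = 0.
    by apply: big1 => k _; apply/eqP; rewrite eq_le f0 (le_trans (fM k)).
  have -> : \sum_i g i = 0.
    by apply: big1 => k _; apply/eqP; rewrite eq_le g0 (le_trans (gM k)).
  by rewrite addr0 mulr_ge0 // sumr_ge0.
pose A := [set i | 0 < f i]; pose B := [set i | 0 < g i].
have iA : i \in A by rewrite inE fi.
have jB : j \in B by rewrite inE gj.
pose fm := f [arg min_(k < i | k \in A) f k]%O.
pose gm := g [arg min_(k < j | k \in B) g k]%O.
have [fm0 fmP [i1 i1A fmE]] : [/\ 0 < fm, forall k, 0 < f k -> fm <= f k &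
    exists2 i1, i1 \in A & f i1 = fm].
  rewrite /fm; case: arg_minP => // k kA kmin; split;
    [|by move=> l l0; apply: kmin; rewrite inE|by exists k].
  by move: kA; rewrite inE.
have [gm0 gmP [j1 j1B gmE]] : [/\ 0 < gm, forall k, 0 < g k -> gm <= g k &
    exists2 j1, j1 \in B & g j1 = gm].
  rewrite /gm; case: arg_minP => // k kA kmin; split;
    [|by move=> l l0; apply: kmin; rewrite inE|by exists k].
  by move: kA; rewrite inE.
pose v := Num.min fm gm.
have v0 : 0 < v by rewrite lt_min fm0.
have vf k : 0 < f k -> v <= f k by move=> /fmP; apply: le_trans; rewrite ge_min lexx.
have vg k : 0 < g k -> v <= g k by move=> /gmP; apply: le_trans; rewrite ge_min lexx orbT.
pose f' k := if 0 < f k then f k - v else 0.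
pose g' k := if 0 < g k then g k - v else 0.
pose h' k := Num.max (h k - v) 0.
have vM : v <= M by rewrite -fi; apply: vf; rewrite fi.
have ineq : \sum_i f' i + \sum_i g' i <= 2 * \sum_i h' i.
  apply: (IH f' g' h' (M - v)).
  - have sA : [set k | 0 < f' k] \subset A.
      by apply/subsetP => k; rewrite !inE /f'; case: ifP; rewrite ?ltxx.
    have sB : [set k | 0 < g' k] \subset B.
      by apply/subsetP => k; rewrite !inE /g'; case: ifP; rewrite ?ltxx.
    rewrite -ltnS; apply: leq_trans ltn; rewrite ltnS.
    have [fg|fg] := leP fm gm.
      rewrite -addSn leq_add ?subset_leq_card //; apply: proper_card.
      rewrite properE sA; apply/subsetPn; exists i1 => //.
      rewrite inE /f'; move: i1A; rewrite inE => ->.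
      by rewrite fmE /v min_l // subrr ltxx.
    rewrite -addnS leq_add ?subset_leq_card //; apply: proper_card.
    rewrite properE sB; apply/subsetPn; exists j1 => //.
    rewrite inE /g'; move: j1B; rewrite inE => ->.
    by rewrite gmE /v min_r ?ltW // subrr ltxx.
  - by move=> k; rewrite /f'; case: ifP => // /vf; rewrite subr_ge0.
  - by move=> k; rewrite /g'; case: ifP => // /vg; rewrite subr_ge0.
  - by move=> k; rewrite /h' le_max lexx orbT.
  - by move=> k; rewrite /f'; case: ifP => _; rewrite ?lerD2r // subr_ge0.
  - by move=> k; rewrite /g'; case: ifP => _; rewrite ?lerD2r // subr_ge0.
  - by exists i; rewrite /f' fi M0.
  - by exists j; rewrite /g' gj M0.
  - move=> a b c e /hmin; rewrite /f' /g' /h'.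
    case: ifP => [fa|_ _]; last by rewrite ge_min !le_max lexx !orbT.
    case: ifP => [gb|_ _]; last by rewrite ge_min !le_max lexx !orbT.
    by rewrite le_max !ge_min !lerD2r => ->.
(* The removed layers are v times the indicators of A and B. On C, which contains the rounded
   midpoints of A and B, h loses exactly v. *)
pose C := [set k | v <= h k].
have cardABC : (#|A| + #|B| <= #|C| * 2)%N.
  apply: leq_card_midset => [||a b c e]; [by apply/set0Pn; exists i|by apply/set0Pn; exists j|].
  rewrite !inE => /vf fa /vg gb /hmin; apply: le_trans.
  by rewrite le_min fa gb.
have fE : \sum_k f k = \sum_k f' k + v * #|A|%:R.
  rewrite -sum1_card natr_sum mulr_sumr [X in _ + X]big_mkcond -big_split /=.
  apply: eq_bigr => k _; rewrite inE /f'; case: ifP => hk; first by rewrite mulr1 subrK.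
  by rewrite addr0; apply/eqP; rewrite eq_le f0 andbT leNgt hk.
have gE : \sum_k g k = \sum_k g' k + v * #|B|%:R.
  rewrite -sum1_card natr_sum mulr_sumr [X in _ + X]big_mkcond -big_split /=.
  apply: eq_bigr => k _; rewrite inE /g'; case: ifP => hk; first by rewrite mulr1 subrK.
  by rewrite addr0; apply/eqP; rewrite eq_le g0 andbT leNgt hk.
have hE : \sum_k h' k + v * #|C|%:R <= \sum_k h k.
  rewrite -sum1_card natr_sum mulr_sumr [X in _ + X <= _]big_mkcond -big_split /=.
  apply: ler_sum => k _; rewrite inE /h' mulr1; case: (leP v (h k)) => hk.
    by rewrite max_l ?subr_ge0 // subrK.
  by rewrite max_r ?addr0 ?h0 // subr_le0 ltW.
have : v * #|A|%:R + v * #|B|%:R <= v * #|C|%:R * 2.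
  by rewrite -mulrDr -mulrA ler_pM2l // -natrD -natrM ler_nat.
rewrite fE gE; lra.
Qed.

(** Dividing f and g by their maxima F and G, and h by sqrt(F G), makes the maxima equal. Since
    min(u, v) <= sqrt(u v), [sum_midpoint_min] applies, and AM-GM turns its bound on the sum into
    one on the product. *)
Lemma sum_midpoint_geom f g h :
  (forall i, 0 <= f i) -> (forall i, 0 <= g i) -> (forall i, 0 <= h i) ->
  (forall (a b c : 'I_L) (e : bool), c = (a + b + e)./2 :> nat ->
     f a * g b <= h c ^+ 2) ->
  (\sum_i f i) * (\sum_i g i) <= (\sum_i h i) ^+ 2.
Proof.
move=> f0 g0 h0 hyp.
have [i fi|/(_ _)/negP fN] := pickP (fun i => 0 < f i); last first.
  rewrite big1 ?mul0r ?sqr_ge0 // => i _; apply/eqP; rewrite eq_le f0 andbT leNgt.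
  exact/negP.
have [j gj|/(_ _)/negP gN] := pickP (fun i => 0 < g i); last first.
  rewrite [X in _ * X]big1 ?mulr0 ?sqr_ge0 // => k _; apply/eqP; rewrite eq_le g0 andbT leNgt.
  exact/negP.
pose i1 := [arg max_(k > i) f k]%O; pose j1 := [arg max_(k > j) g k]%O.
have fmax k : f k <= f i1 by rewrite /i1; case: arg_maxP => // l _; apply.
have gmax k : g k <= g j1 by rewrite /j1; case: arg_maxP => // l _; apply.
set F := f i1 in fmax; set G := g j1 in gmax.
have F0 : 0 < F by apply: lt_le_trans fi (fmax _).
have G0 : 0 < G by apply: lt_le_trans gj (gmax _).
pose S := Num.sqrt (F * G).
have S0 : 0 < S by rewrite sqrtr_gt0 mulr_gt0.
have S2 : S ^+ 2 = F * G by rewrite sqr_sqrtr // mulr_ge0 // ltW.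
have H : \sum_i f i / F + \sum_i g i / G <= 2 * (\sum_i h i / S).
  apply: (@sum_midpoint_min _ _ _ 1).
  - by move=> k; rewrite divr_ge0 // ltW.
  - by move=> k; rewrite divr_ge0 // ltW.
  - by move=> k; rewrite divr_ge0 // ltW.
  - by move=> k; rewrite ler_pdivrMr // mul1r.
  - by move=> k; rewrite ler_pdivrMr // mul1r.
  - by exists i1; rewrite divff ?gt_eqF.
  - by exists j1; rewrite divff ?gt_eqF.
  - move=> a b c e /hyp ab.
    set u := f a / F; set v := g b / G.
    have u0 : 0 <= u by rewrite divr_ge0 // ltW.
    have v0 : 0 <= v by rewrite divr_ge0 // ltW.
    have : u * v <= (h c / S) ^+ 2.
      rewrite expr_div_n S2 /u /v mulf_div ler_pM2r ?invr_gt0 ?mulr_gt0 //.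
    have w0 : 0 <= h c / S by rewrite divr_ge0 // ltW.
    move=> uv; rewrite ge_min; apply/orP.
    have [wu|] := leP u (h c / S); [by left|move=> wu; right].
    rewrite leNgt; apply/negP => wv.
    move: uv; apply/negP; rewrite -ltNge expr2.
    by apply: ltr_pM.
move: H; rewrite -!mulr_suml.
set sf := \sum_i f i; set sg := \sum_i g i; set sh := \sum_i h i => H.
have H2 : sf * sg / (F * G) <= sh ^+ 2 / (F * G).
  rewrite -S2 -expr_div_n S2 -mulf_div.
  have : 0 <= sf / F by apply: divr_ge0; [exact: sumr_ge0 | exact: ltW].
  have : 0 <= sg / G by apply: divr_ge0; [exact: sumr_ge0 | exact: ltW].
  move: H; set x := sf / F; set y := sg / G; set z := sh / S => H y0 x0.
  have h1 : 0 <= (2 * z - x - y) * (2 * z + x + y) by apply: mulr_ge0; lra.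
  by have := sqr_ge0 (x - y); nra.
by rewrite ler_pM2r ?invr_gt0 ?mulr_gt0 // in H2.
Qed.

End Prekopa.

Section Cube.
Variables (K : rcfType) (d L : nat).
Local Notation T := {ffun 'I_d -> 'I_L}.
Implicit Types (D : {set 'I_d}) (A B C : {set T}) (x y : T).

Definition ffun_upd (V : Type) (x : {ffun 'I_d -> V}) j v : {ffun 'I_d -> V} :=
  [ffun i => if i == j then v else x i].

(* The number of points of A that agree with x off D. *)
Definition fiber_card D A x : nat :=
  #|[set y in A | [forall j, (j \notin D) ==> (y j == x j)]]|.

Lemma fiber_card0 A x : fiber_card set0 A x = (x \in A).
Proof.
rewrite /fiber_card; case: (boolP (x \in A)) => xA.
  rewrite (_ : [set y in A | _] = [set x]) ?cards1 //.
  apply/setP => y; rewrite !inE; apply/andP/eqP => [[_ /forallP h]|->].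
    by apply/ffunP => j; apply/eqP; have := h j; rewrite in_set0.
  by split=> //; apply/forallP => j; rewrite eqxx implybT.
apply/eqP; rewrite cards_eq0; apply/eqP/setP => y; rewrite !inE.
apply/andP => -[yA /forallP h]; move/negP: xA; apply.
suff <- : y = x by [].
by apply/ffunP => j; apply/eqP; have := h j; rewrite in_set0.
Qed.

Lemma fiber_cardT A x : fiber_card setT A x = #|A|.
Proof.
apply: eq_card => y; rewrite !inE; case: (y \in A) => //=.
by apply/forallP => j; rewrite inE.
Qed.

Lemma fiber_cardU1 D A x j : j \notin D ->
  fiber_card (j |: D) A x = (\sum_v fiber_card D A (ffun_upd x j v))%N.
Proof.
move=> jD; rewrite /fiber_card -sum1_card (partition_big (fun y : T => y j) predT) //=.
apply: eq_bigr => v _; rewrite -sum1_card; apply: eq_bigl => y; rewrite !inE.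
case: (y \in A) => //=; apply/andP/forallP => [[/forallP h /eqP yj] i|h].
  apply/implyP => iD; rewrite ffunE; case: (i =P j) => [->|/eqP ij]; first by rewrite yj.
  by have := h i; rewrite !inE negb_or ij iD => /implyP; apply.
split; last by have := h j; rewrite jD ffunE eqxx => /implyP; apply.
apply/forallP => i; apply/implyP; rewrite !inE negb_or => /andP[ij iD].
by have := h i; rewrite iD ffunE (negPf ij).
Qed.

(* Prekopa-Leindler, one coordinate at a time: the inequality for the fibers in
   the directions D implies the one for [j |: D]. *)
Lemma card_midcube A B C :
  (forall (a b c : T) (e : {ffun 'I_d -> bool}), a \in A -> b \in B ->
     (forall i, c i = (a i + b i + e i)./2 :> nat) -> c \in C) ->
  (#|A|%:R * #|B|%:R : K) <= #|C|%:R ^+ 2.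
Proof.
move=> midC.
suff H : forall D, forall (a b c : T) (e : {ffun 'I_d -> bool}),
    (forall i, c i = (a i + b i + e i)./2 :> nat) ->
  ((fiber_card D A a)%:R * (fiber_card D B b)%:R : K) <= (fiber_card D C c)%:R ^+ 2.
  case: (posnP #|A|) => [->|]; first by rewrite mul0r sqr_ge0.
  case: (posnP #|B|) => [->|]; first by rewrite mulr0 sqr_ge0.
  move=> /card_gt0P[b bB] /card_gt0P[a aA].
  have lt i : ((a i + b i)./2 < L)%N.
    by have := ltn_ord (a i); have := ltn_ord (b i); lia.
  have := H setT a b [ffun i => Ordinal (lt i)] [ffun=> false].
  by rewrite !fiber_cardT; apply => i; rewrite !ffunE /= addn0.
move=> D; have [n] := ubnP #|D|; elim: n D => // n IH D.
have [->|/set0Pn[j jD]] := eqVneq D set0.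
  move=> _ a b c e ce; rewrite !fiber_card0.
  case: (boolP (a \in A)) => [aA|_]; last by rewrite mul0r sqr_ge0.
  case: (boolP (b \in B)) => [bB|_]; last by rewrite mulr0 sqr_ge0.
  by rewrite (midC _ _ _ _ aA bB ce) mulr1 expr1n.
rewrite (cardsD1 j) jD ltnS => ltn a b c e ce.
rewrite -(setD1K jD) !fiber_cardU1 ?setD11 // !natr_sum.
apply: sum_midpoint_geom => [v|v|v|v w u s us]; rewrite ?ler0n //.
apply: (IH _ _ _ _ _ (ffun_upd e j s)) => // i; rewrite !ffunE.
by case: (i =P j) => // _; rewrite us.
Qed.


Lemma card_slab_line (A : {set 'I_L}) (lo hi c w : K) :
  w != 0 -> lo <= hi -> (forall v : 'I_L, v \in A -> lo <= w * v%:R + c < hi) ->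
  #|A|%:R <= (hi - lo) / `|w| + 1.
Proof.
move=> w0 lohi hA; have wp : 0 < `|w| by rewrite normr_gt0.
have [->|/set0Pn[v0 v0A]] := eqVneq A set0.
  by rewrite cards0; apply: addr_ge0 => //; apply: divr_ge0; rewrite ?subr_ge0.
have [a aA amin] := arg_minnP (fun i : 'I_L => i : nat) v0A.
have [b bA bmax] := arg_maxnP (fun i : 'I_L => i : nat) v0A.
have ab : (a <= b)%N by apply: amin.
have cA : (#|A| <= (b - a).+1)%N.
  rewrite cardE -(size_map (fun i : 'I_L => i : nat)) -(size_iota a (b - a).+1).
  apply: uniq_leq_size.
    by rewrite map_inj_uniq ?enum_uniq //; apply: val_inj.
  move=> _ /mapP[x xA ->]; rewrite mem_enum in xA; rewrite mem_iota addnS subnKC //.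
  by rewrite ltnS; apply/andP; split; [apply: amin|apply: bmax].
apply: le_trans (_ : (b - a).+1%:R <= _); first by rewrite ler_nat.
rewrite -natr1 lerD2r ler_pdivlMr // natrB //.
have -> : (b%:R - a%:R) * `|w| = `|(w * b%:R + c) - (w * a%:R + c)|.
  have -> : (w * b%:R + c) - (w * a%:R + c) = w * (b%:R - a%:R) by ring.
  rewrite normrM mulrC; congr (_ * _); rewrite ger0_norm // subr_ge0.
  by rewrite ler_nat.
move: (hA _ aA) (hA _ bA) => /andP[h1 h2] /andP[h3 h4].
by rewrite ler_norml; apply/andP; split; lra.
Qed.

(** The cube is a union of L^(d-1) lines in direction j, and [card_slab_line] bounds the slab on
    each. The induction adds the other directions to the fiber one at a time. *)
Lemma card_slab (w : 'I_d -> K) (lo hi : K) (j : 'I_d) :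
  w j != 0 -> lo <= hi ->
  #|[set x : T | lo <= \sum_i w i * (x i)%:R < hi]|%:R
    <= ((hi - lo) / `|w j| + 1) * L%:R ^+ d.-1.
Proof.
move=> wj lohi; set S := [set x : T | _].
have c0 : 0 <= (hi - lo) / `|w j| + 1.
  by apply: addr_ge0 => //; apply: divr_ge0; rewrite ?subr_ge0.
suff H n D x : #|D| = n -> j \in D ->
    (fiber_card D S x)%:R <= ((hi - lo) / `|w j| + 1) * L%:R ^+ n.-1 :> K.
  have [->|/set0Pn[x _]] := eqVneq S set0.
    by rewrite cards0 mulr_ge0 // exprn_ge0.
  by rewrite -(fiber_cardT S x); apply: H; rewrite ?inE ?cardsT ?card_ord.
elim: n D x => [|n IH] D x cD jD.
  by move/eqP: cD; rewrite cards_eq0 => /eqP D0; rewrite D0 inE in jD.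
have [D0|/set0Pn[i]] := eqVneq (D :\ j) set0.
  move: cD; rewrite (cardsD1 j) jD D0 cards0 => -[<-]; rewrite expr0 mulr1.
  have -> : D = j |: set0 by rewrite -D0 setD1K.
  rewrite fiber_cardU1 ?in_set0 //.
  apply: le_trans (_ : #|[set v | ffun_upd x j v \in S]|%:R <= _).
    rewrite ler_nat -sum1_card [X in (_ <= X)%N]big_mkcond leq_sum // => v _.
    by rewrite fiber_card0 !inE; case: (lo <= _ < hi).
  apply: (@card_slab_line _ lo hi (\sum_(i | i != j) w i * (x i)%:R)) => // v.
  rewrite !inE (bigD1 j) //= ffunE eqxx.
  rewrite (eq_bigr (fun i => w i * (x i)%:R)) // => i ij.
  by rewrite ffunE (negPf ij).
rewrite !inE => /andP[ij iD].
rewrite -(setD1K iD) fiber_cardU1 ?setD11 // natr_sum.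
have cDi : #|D :\ i| = n by move: cD; rewrite (cardsD1 i) iD => -[].
have n0 : (0 < n)%N.
  by rewrite -cDi; apply/card_gt0P; exists j; rewrite !inE eq_sym ij.
apply: le_trans (_ : \sum_(v < L) ((hi - lo) / `|w j| + 1) * L%:R ^+ n.-1 <= _).
  by apply: ler_sum => v _; apply: IH => //; rewrite !inE eq_sym ij.
rewrite sumr_const card_ord -mulrnAr -[_ *+ L]mulr_natr -exprSr
  prednK //.
Qed.

End Cube.

Section Grunbaum.
Variables (K : rcfType) (T : finType) (X : {set T}) (l : T -> K).

Definition tail_card (t : K) : K := #|[set x in X | t <= l x]|%:R.

(** Dyadic layer-cake bound: if (2^k - 1)s is the last threshold reached by a, the weights 1, 2,
    ..., 2^k add up to 2^(k+1) - 1, and a lies below the next threshold. For a < 0 the sum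
    vanishes. *)
Lemma tail_dyadic (s : K) n (a : K) : 0 <= s -> a < (2 ^+ n - 1) * s ->
  a <= s * \sum_(j < n) 2 ^+ j * ((2 ^+ j - 1) * s <= a)%R%:R.
Proof.
move=> s0; elim: n => [|n IH]; first by rewrite big_ord0 expr0 subrr mul0r mulr0 => /ltW.
move=> an; rewrite big_ord_recr /=.
have [/IH h|h] := ltP a ((2 ^+ n - 1) * s).
  apply: le_trans h _; rewrite ler_wpM2l // lerDl mulr0 //.
rewrite mulr1 (eq_bigr (fun j : 'I_n => 2 ^+ j)); last first.
  move=> j _; rewrite (_ : _ <= _) ?mulr1 //; apply: le_trans h.
  by rewrite ler_wpM2r // lerD2r ler_eXn2l ?ltr1n // ltnW.
have -> : \sum_(j < n) 2 ^+ j = 2 ^+ n - 1 :> K.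
  by rewrite subrX1 (_ : 2 - 1 = 1 :> K) ?mul1r //; ring.
by apply: le_trans (ltW an) _; rewrite exprS; lra.
Qed.

(** Here b and c stand for consecutive dyadic tails and f for 4^j. The hypotheses give c + theta W
    <= 21 W / (200 f), so b <= 2 (21/200)^2 W / f^2, which is below W / (40 f) because f >= 1. This
    is where 1/200 and 1/10 fit together. *)
Lemma dyadic_step (W b c theta f : K) :
  0 < W -> 0 <= theta -> 0 <= b -> 0 <= c -> 1 <= f ->
  theta * f * 200 <= 1 -> c * f * 10 <= W -> W / 2 * b <= (c + theta * W) ^+ 2 ->
  b * (f * 4) * 10 <= W.
Proof.
move=> W0 th0 b0 c0 f1 thf cf h3.
have W0' := ltW W0; have f0 : 0 <= f by apply: le_trans f1.
set e := c + theta * W in h3.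
have e0 : 0 <= e by rewrite addr_ge0 ?mulr_ge0.
have h1 : e * (f * 200) <= 21 * W.
  have : theta * f * 200 * W <= 1 * W by rewrite ler_pM2r.
  by rewrite /e; lra.
have h2 : (e * (f * 200)) ^+ 2 <= (21 * W) ^+ 2.
  by rewrite lerXn2r ?nnegrE ?mulr_ge0.
have h4 : W / 2 * b * (f * 200) ^+ 2 <= (21 * W) ^+ 2.
  by apply: le_trans h2; rewrite [leRHS]exprMn ler_wpM2r // sqr_ge0.
have h5 : W * (b * (f * f) * 20000) <= W * (441 * W).
  rewrite (_ : W * (441 * W) = (21 * W) ^+ 2); last by ring.
  by apply: le_trans h4; rewrite le_eqVlt; apply/orP; left; apply/eqP; field.
rewrite ler_pM2l // in h5.
have h6 : b * f * 1 <= b * f * f by rewrite ler_wpM2l ?mulr_ge0.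
rewrite mulr1 in h6; rewrite -mulrA in h6.
move: h5 h6; rewrite (mulrA b f 4).
set y := b * (f * f); set x := b * f; lra.
Qed.

(* [theta] and the slab condition absorb the discretization.  If [tail_card 0]
   were below a tenth of X, the median value [- s] would be negative, and
   log-concavity between [- s] and [(2 ^+ j.+1 - 1) * s], whose midpoint is
   [(2 ^+ j - 1) * s], would make the positive part of [l] too light to balance
   the mass below [- s]. *)
Lemma grunbaum (J : nat) (theta Delta : K) :
  (0 < #|X|)%N -> \sum_(x in X) l x = 0 ->
  0 <= theta -> theta * 4 ^+ J <= 1 / 200 ->
  (forall s t, tail_card s * tail_card t <= (tail_card ((s + t) / 2) + theta * #|X|%:R) ^+ 2) ->
  (forall x, x \in X -> l x <= Delta) ->
  (forall s : K, 0 < s ->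
     2 / 5 * #|X|%:R <= #|[set x in X | - s <= l x < 0]|%:R :> K ->
     Delta < (2 ^+ J.+1 - 1) * s) ->
  #|X|%:R <= 10 * tail_card 0.
Proof.
move=> X0 sum0 th0 thJ logc lD slab; rewrite leNgt; apply/negP => small.
set W : K := #|X|%:R in logc slab small *.
have W0 : 0 < W by rewrite ltr0n.
have tail_mono s t : s <= t -> tail_card t <= tail_card s.
  move=> st; rewrite ler_nat subset_leq_card //; apply/subsetP => x; rewrite !inE.
  by move=> /andP[-> /(le_trans st)].
case/card_gt0P: X0 => x1 x1X.
(* The maximizer y of l on P is a median: at least half of X lies at or above [l y], and at most
   half strictly above. *)
pose P := [pred x in X | W <= 2 * tail_card (l x)].
have [x0 Px0] : exists x0, P x0.
  case: (@arg_minP _ _ _ x1 (fun x => x \in X) l x1X) => y yX ymin; exists y.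
  rewrite /P /= yX /tail_card (_ : [set x in X | _] = X) -/W; first lra.
  by apply/setP => x; rewrite inE; case: (boolP (x \in X)) => //= xX; rewrite ymin.
case: (@arg_maxP _ _ _ x0 P l Px0) => y /andP[/= yX Wy] ymax.
have half : 2 * #|[set x in X | l y < l x]|%:R <= W.
  have [->|/set0Pn[z zS]] := eqVneq [set x in X | l y < l x] set0.
    by rewrite cards0 mulr0 ltW.
  case: (@arg_minP _ _ _ z (fun u => u \in [set x in X | l y < l x]) l zS) => u uS umin.
  have /andP[uX yu] : (u \in X) && (l y < l u) by move: uS; rewrite /= inE.
  have h : 2 * tail_card (l u) < W.
    rewrite ltNge; apply/negP => h; have := ymax u.
    by rewrite uX h leNgt yu => /(_ isT).
  apply: ltW; apply: le_lt_trans h.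
  rewrite ler_pM2l // ler_nat subset_leq_card //; apply/subsetP => x xS.
  by move: (xS); rewrite !inE => /andP[-> _] /=; apply: umin.
have ly0 : l y < 0.
  by rewrite ltNge; apply/negP => /tail_mono; move: (small) (Wy) W0; lra.
pose s := - l y; have s0 : 0 < s by rewrite oppr_gt0.
have tails : W <= 2 * tail_card (- s) by rewrite opprK.
have cslab : 2 / 5 * W <= #|[set x in X | - s <= l x < 0]|%:R.
  have : tail_card (- s) <= #|[set x in X | - s <= l x < 0]|%:R + tail_card 0.
    rewrite -natrD ler_nat -cardsUI; apply: leq_trans (leq_addr _ _).
    apply: subset_leq_card; apply/subsetP => x; rewrite !inE => /andP[-> ->] /=.
    by rewrite ltNge orNb.
  lra.
have Ds := slab _ s0 cslab.
have q j : (j <= J)%N -> tail_card ((2 ^+ j - 1) * s) * 4 ^+ j * 10 <= W.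
  elim: j => [|j IH] jJ; first by rewrite !expr0 subrr mul0r mulr1 mulrC ltW.
  have {IH} IH := IH (ltnW jJ).
  have := logc (- s) ((2 ^+ j.+1 - 1) * s).
  rewrite (_ : (- s + _) / 2 = (2 ^+ j - 1) * s); last by rewrite exprS; field.
  set a := tail_card (- s) in tails *; set b := tail_card _; set c := tail_card _ in IH *.
  move=> abc.
  have f0 : 0 < 4 ^+ j :> K by rewrite exprn_gt0.
  have thj : theta * 4 ^+ j * 200 <= 1.
    have : theta * 4 ^+ j <= theta * 4 ^+ J.
      by rewrite ler_wpM2l // ler_eXn2l ?ltr1n // ltnW.
    lra.
  rewrite exprSr; apply: (dyadic_step W0 th0 _ _ _ thj IH); rewrite ?ler0n //.
    by rewrite exprn_ege1 // ler1n.
  by apply: le_trans abc; rewrite ler_wpM2r ?ler0n //; lra.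
(* The balance: the half of X at or below - s contributes at most - s W / 2, while by [q] the dyadic
   bound on the rest sums to at most s W / 5, a geometric series. The total would be negative. *)
have : \sum_(x in X) l x <= - s * (W / 2) +
    \sum_(x in X) s * \sum_(j < J.+1) 2 ^+ j * ((2 ^+ j - 1) * s <= l x)%R%:R.
  have cle : W / 2 <= #|[set x in X | l x <= - s]|%:R.
    have : W <= #|[set x in X | l y < l x]|%:R + #|[set x in X | l x <= - s]|%:R.
      rewrite -natrD ler_nat -cardsUI; apply: leq_trans (leq_addr _ _).
      apply: subset_leq_card; apply/subsetP => x xX; rewrite !inE xX /= opprK.
      by rewrite ltNge orNb.
    lra.
  have cle' : - s * #|[set x in X | l x <= - s]|%:R <= - s * (W / 2).
    by rewrite ler_nM2l // oppr_lt0.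
  apply: le_trans (lerD cle' (lexx _)).
  have -> : - s * #|[set x in X | l x <= - s]|%:R = \sum_(x in X) (- s) * (l x <= - s)%R%:R.
    rewrite -mulr_sumr -natr_sum -sum1_card big_mkcond [in RHS]big_mkcond /=; congr (_ * _%:R).
    by apply: eq_bigr => x _; rewrite inE; case: (x \in X) => //=; case: (_ <= _).
  rewrite -big_split /=; apply: ler_sum => x xX.
  have [h|h] := leP (l x) (- s).
    rewrite mulr1; apply: le_trans h _; rewrite lerDl mulr_ge0 ?(ltW s0) //.
    by apply: sumr_ge0 => j _; rewrite mulr_ge0 ?ler0n // exprn_ge0.
  rewrite mulr0 add0r; apply: tail_dyadic; first exact: ltW.
  by apply: le_lt_trans Ds; apply: lD.
rewrite sum0 -mulr_sumr exchange_big /=.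
have -> : \sum_(j < J.+1) \sum_(x in X) 2 ^+ j * ((2 ^+ j - 1) * s <= l x)%R%:R
   = \sum_(j < J.+1) 2 ^+ j * tail_card ((2 ^+ j - 1) * s).
  apply: eq_bigr => j _; rewrite -mulr_sumr -natr_sum /tail_card -sum1_card big_mkcond.
  rewrite [in RHS]big_mkcond /=; congr (_ * _%:R).
  by apply: eq_bigr => x _; rewrite inE; case: (x \in X) => //=; case: (_ <= _).
have : \sum_(j < J.+1) 2 ^+ j * tail_card ((2 ^+ j - 1) * s) <= \sum_(j < J.+1) W / 10 * 2 ^- j.
  apply: ler_sum => j _; have := q j (leq_ord j).
  have p0 : 0 < 2 ^+ j :> K by rewrite exprn_gt0.
  rewrite (_ : 4 = 2 * 2 :> K) ?exprMn; last by rewrite -natrM.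
  rewrite -[X in _ -> _ <= X]/(_ / 2 ^+ j) ler_pdivlMr //; lra.
have -> : \sum_(j < J.+1) W / 10 * 2 ^- j = W / 10 * (2 - 2 ^- J).
  rewrite -mulr_sumr; congr (_ * _); elim: (J) => [|n IH].
    by rewrite big_ord_recr big_ord0 /= !expr0 invr1; ring.
  by rewrite big_ord_recr IH /= exprS invfM; set x := (2 ^+ n)^-1; field.
have : 0 <= W / 10 * 2 ^- J by rewrite mulr_ge0 ?invr_ge0 ?exprn_ge0 // ltW // divr_gt0.
set S := \sum_(j < _) _ => h1 h2 h3.
have h4 : S <= W / 5 by lra.
have : s * S <= s * (W / 5) by rewrite ler_pM2l.
have : 0 < s * W by rewrite mulr_gt0.
lra.
Qed.

End Grunbaum.

Section CubeCenter.
Variables (K : rcfType) (d L : nat).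
Local Notation T := {ffun 'I_d -> 'I_L}.
Implicit Types (w : 'I_d -> K) (x y : T) (cs : seq (('I_d -> K) * K)).

Definition lin w x : K := \sum_i w i * (x i)%:R.

Definition cube_cell cs : {set T} := [set x | all (fun c => lin c.1 x < c.2) cs].

Lemma sum_norm_le w j : (forall i, `|w i| <= `|w j|) ->
  \sum_i `|w i| <= d%:R * `|w j|.
Proof.
move=> h; rewrite -[d in d%:R]card_ord mulr_natl -sumr_const.
exact: ler_sum.
Qed.

(** In each coordinate the choice of e and the halving together move the midpoint by at most 1/2. *)
Lemma lin_mid w x y (z : T) (e : {ffun 'I_d -> bool}) :
  (forall i, z i = (x i + y i + e i)./2 :> nat) ->
  `|lin w z - (lin w x + lin w y) / 2| <= (\sum_i `|w i|) / 2.
Proof.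
move=> ze; rewrite /lin -big_split /= !mulr_suml -sumrB.
apply: le_trans (ler_norm_sum _ _ _) _; apply: ler_sum => i _.
rewrite -mulrDr -mulrA -mulrBr normrM ler_wpM2l // ze.
have := odd_double_half (x i + y i + e i).
set h := (_ + _ + _)./2; set o := odd _ => oh.
have : (x i)%:R + (y i)%:R + (e i)%:R = (o : nat)%:R + h%:R * 2 :> K.
  by rewrite -natrM -!natrD -oh muln2.
have : 0 <= ((e i)%:R : K) <= 1 by case: (e i); rewrite /= ?ler01 ?lexx.
have : 0 <= ((o : nat)%:R : K) <= 1 by case: (o); rewrite /= ?ler01 ?lexx.
by move=> /andP[? ?] /andP[? ?] ?; rewrite ler_norml; apply/andP; split; lra.
Qed.

(** Slicing along the largest coefficient [w j] makes the bound independent of w: the width is at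
    most d |w j| / 2. *)
Lemma card_mid_slab w (lo : K) :
  #|[set x : T | lo <= lin w x < lo + (\sum_i `|w i|) / 2]|%:R
     <= (d%:R + 1) * L%:R ^+ d.-1 :> K.
Proof.
have r0 : 0 <= (d%:R + 1) * L%:R ^+ d.-1 :> K.
  by rewrite mulr_ge0 ?addr_ge0 ?exprn_ge0.
have [i wi|w0] := pickP (fun i => w i != 0); last first.
  rewrite (_ : [set x | _] = set0) ?cards0 //; apply/setP => x; rewrite !inE.
  rewrite big1 ?mul0r ?addr0; last by move=> k _; have /eqP-> := negbFE (w0 k); rewrite normr0.
  by rewrite ltNge andbN.
pose j := [arg max_(k > i) `|w k|]%O.
have jmax k : `|w k| <= `|w j| by rewrite /j; case: arg_maxP => // l _; apply.
have wj : 0 < `|w j| by apply: lt_le_trans (jmax i); rewrite normr_gt0.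
have s0 : 0 <= \sum_i `|w i| by apply: sumr_ge0.
apply: le_trans (card_slab (j := j) _ _ _) _; first by rewrite -normr_gt0.
  by rewrite lerDl divr_ge0.
rewrite ler_wpM2r ?exprn_ge0 // lerD2r addrC addKr ler_pdivrMr //.
have := sum_norm_le jmax; lra.
Qed.

(* Rounding midpoints leaves a cell only through a thin slab along each facet. *)
Lemma card_near_cell cs (C : {set T}) :
  (forall x, x \in C ->
     all (fun c => lin c.1 x < c.2 + (\sum_i `|c.1 i|) / 2) cs) ->
  #|C|%:R <= #|C :&: cube_cell cs|%:R
     + (size cs)%:R * ((d%:R + 1) * L%:R ^+ d.-1) :> K.
Proof.
elim: cs => [|c cs IH] hC.
  rewrite mul0r addr0 ler_nat subset_leq_card //.
  by apply/subsetP => x xC; rewrite !inE xC.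
have {}IH : #|C|%:R <= #|C :&: cube_cell cs|%:R
     + (size cs)%:R * ((d%:R + 1) * L%:R ^+ d.-1) :> K.
  by apply: IH => x /hC /andP[].
have key : #|C :&: cube_cell cs|%:R <= #|C :&: cube_cell (c :: cs)|%:R
     + (d%:R + 1) * L%:R ^+ d.-1 :> K.
  apply: le_trans (lerD (lexx _) (card_mid_slab c.1 c.2)).
  rewrite -natrD ler_nat -cardsUI; apply: leq_trans (leq_addr _ _).
  apply: subset_leq_card; apply/subsetP => x; rewrite !inE => /andP[xC xcs].
  by have /andP[-> _] := hC _ xC; rewrite xC /= xcs !andbT leNgt orbN.
rewrite [size _]/= -natr1 mulrDl mul1r; lra.
Qed.

(** gamma is a lower bound on the density of the cell. The relative rounding error [theta] counts u
    slabs for the facets and one for the tail; the hypothesis with 200 bounds theta 4^J. The other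
    two fineness conditions ensure that J doublings of s exceed the range of l. *)
Lemma cube_center (gamma : K) (J u : nat) cs w (mu : K) :
  0 < gamma -> 5 * d%:R < gamma * 2 ^+ J -> 5 <= gamma * L%:R ->
  200 * (u.+1%:R * (d%:R + 1)) * 4 ^+ J <= gamma * L%:R ->
  (0 < d)%N -> (size cs <= u)%N -> gamma * L%:R ^+ d <= #|cube_cell cs|%:R ->
  \sum_(x in cube_cell cs) (lin w x - mu) = 0 ->
  #|cube_cell cs|%:R <= 10 * #|[set x in cube_cell cs | mu <= lin w x]|%:R :> K.
Proof.
move=> gam0 hJ hL hu d0 su; set X := cube_cell cs => Xbig sum0.
have L0 : 0 < L%:R :> K by rewrite -(pmulr_rgt0 _ gam0); apply: lt_le_trans hL.
have Ld : L%:R ^+ d = L%:R * L%:R ^+ d.-1 :> K by rewrite -exprS prednK.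
have Lp : 0 < L%:R ^+ d.-1 :> K by rewrite exprn_gt0.
have W0 : 0 < #|X|%:R :> K.
  by apply: lt_le_trans Xbig; rewrite mulr_gt0 // exprn_gt0.
have [i wi|w0] := pickP (fun i => w i != 0); last first.
  have lin0 x : lin w x = 0.
    by apply: big1 => k _; have /eqP-> := negbFE (w0 k); rewrite mul0r.
  have mu0 : mu = 0.
    move: sum0; rewrite (eq_bigr (fun=> - mu)); last by move=> x _; rewrite lin0 sub0r.
    rewrite sumr_const -mulr_natr => /eqP; rewrite mulf_eq0 (gt_eqF W0) orbF oppr_eq0.
    by move/eqP.
  rewrite (_ : [set x in X | _] = X).
    by rewrite -[leLHS]mul1r ler_pM2r // ler1n.
  by apply/setP => x; rewrite inE lin0 mu0 lexx andbT.
pose j := [arg max_(k > i) `|w k|]%O.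
have jmax k : `|w k| <= `|w j| by rewrite /j; case: arg_maxP => // l _; apply.
have wj : 0 < `|w j| by apply: lt_le_trans (jmax i); rewrite normr_gt0.
have wj0 : w j != 0 by rewrite -normr_gt0.
pose l x := lin w x - mu.
pose tau : K := (d%:R + 1) * L%:R ^+ d.-1.
pose theta : K := u.+1%:R * (d%:R + 1) / (gamma * L%:R).
have gL : 0 < gamma * L%:R by rewrite mulr_gt0.
have th0 : 0 <= theta by rewrite divr_ge0 ?(ltW gL) // mulr_ge0 // addr_ge0.
have thW : u.+1%:R * tau <= theta * #|X|%:R.
  apply: le_trans (_ : theta * (gamma * L%:R ^+ d) <= _); last by rewrite ler_wpM2l.
  rewrite Ld (mulrA gamma) /theta mulrA divfK ?gt_eqF // /tau mulrA //.
have tailE t : tail_card X l t = #|[set x in X | t + mu <= lin w x]|%:R.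
  rewrite /tail_card; congr (_%:R); apply: eq_card => x; rewrite !inE /l.
  by rewrite lerBrDr.
have -> : #|[set x in X | mu <= lin w x]|%:R = tail_card X l 0 by rewrite tailE add0r.
apply: (@grunbaum _ _ X l J theta (d%:R * `|w j| * L%:R)) => //.
- by rewrite -(ltr0n K).
- rewrite /theta mulrAC ler_pdivrMr // mulrC; lra.
- move=> s t.
  (* C is the set of all rounded midpoints of A and B. By [card_midcube] it is large enough; it
     leaves the cell through at most u slabs, and the tail at (s + t) / 2 through one more. *)
  pose A := [set x in X | s <= l x]; pose B := [set x in X | t <= l x].
  pose C := [set c : T | [exists a, [exists b, [exists e : {ffun 'I_d -> bool},
     [&& a \in A, b \in B & [forall i, c i == (a i + b i + e i)./2 :> nat]]]]]].
  have CP c : c \in C -> exists a b e, [/\ a \in A, b \in B &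
     forall i, c i = (a i + b i + (e : {ffun 'I_d -> bool}) i)./2 :> nat].
    rewrite inE => /existsP[a /existsP[b /existsP[e /and3P[aA bB /forallP h]]]].
    by exists a, b, e; split => // k; apply/eqP.
  have AB : tail_card X l s * tail_card X l t <= #|C|%:R ^+ 2.
    apply: card_midcube => a b c e aA bB ce; rewrite inE.
    apply/existsP; exists a; apply/existsP; exists b; apply/existsP; exists e.
    by rewrite aA bB; apply/forallP => k; apply/eqP.
  have tail0 : 0 <= tail_card X l ((s + t) / 2) by rewrite ler0n.
  apply: le_trans AB _; rewrite lerXn2r ?nnegrE ?(addr_ge0 tail0 (mulr_ge0 th0 (ler0n _ _))) //.
  have h1 : #|C|%:R <= #|C :&: X|%:R + (size cs)%:R * tau :> K.
    apply: card_near_cell => x /CP[a [b [e [aA bB xe]]]].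
    move: aA bB; rewrite !inE => /andP[aX _] /andP[bX _].
    elim: (cs) aX bX => //= c cs' IH /andP[ac acs] /andP[bc bcs].
    rewrite IH // andbT.
    have := lin_mid c.1 xe; rewrite ler_norml => /andP[_]; lra.
  have h2 : #|C :&: X|%:R <= tail_card X l ((s + t) / 2) + tau.
    have := card_mid_slab w ((s + t) / 2 + mu - (\sum_i `|w i|) / 2).
    rewrite subrK -/tau => h; apply: le_trans (lerD (lexx _) h).
    rewrite -natrD ler_nat -cardsUI; apply: leq_trans (leq_addr _ _).
    apply: subset_leq_card; apply/subsetP => x; rewrite inE => /andP[/CP[a [b [e [aA bB xe]]]] xX].
    have sa : s <= l a by move: aA; rewrite inE => /andP[].
    have tb : t <= l b by move: bB; rewrite inE => /andP[].
    rewrite in_setU [x \in [set _ | _]]inE xX [in X in _ || X]inE.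
    have := lin_mid w xe; rewrite ler_norml => /andP[h' _].
    have h3 : (s + t) / 2 + mu - (\sum_i `|w i|) / 2 <= lin w x.
      by move: sa tb; rewrite /l; lra.
    by rewrite h3 /= /l lerBrDr leNgt orNb.
  have h3 : (size cs)%:R * tau <= u%:R * tau.
    by rewrite ler_wpM2r ?ler_nat // mulr_ge0 ?addr_ge0 // ltW.
  have h4 : u.+1%:R * tau = u%:R * tau + tau by rewrite -natr1 mulrDl mul1r.
  apply: le_trans h1 _; apply: le_trans (lerD h2 h3) _.
  by rewrite -addrA lerD2l [tau + _]addrC -h4.
(* As l sums to zero, some y has l y <= 0, so l x is at most the oscillation of l over the cube. *)
- move=> x xX; have [y yX ly] : exists2 y, y \in X & l y <= 0.
    apply/exists_inP; rewrite -[X in is_true X]negbK negb_exists_in; apply/negP => /forall_inP h.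
    have : 0 < \sum_(x in X) l x.
      rewrite (bigD1 x) //= ltr_pwDl //; first by rewrite ltNge h.
      by apply: sumr_ge0 => y /andP[/h]; rewrite -ltNge => /ltW.
    by rewrite sum0 ltxx.
  apply: le_trans (_ : l x - l y <= _); first by lra.
  rewrite /l opprB addrA subrK /lin -sumrB.
  apply: le_trans (ler_norm _) _; apply: le_trans (ler_norm_sum _ _ _) _.
  apply: le_trans (_ : \sum_i `|w i| * L%:R <= _).
    apply: ler_sum => k _; rewrite -mulrBr normrM ler_wpM2l //.
    have hx : 0 <= ((x k)%:R : K) <= L%:R by rewrite ler0n ler_nat ltnW.
    have hy : 0 <= ((y k)%:R : K) <= L%:R by rewrite ler0n ler_nat ltnW.
    by rewrite ler_norml; apply/andP; split; lra.
  by rewrite -mulr_suml ler_wpM2r ?(ltW L0) // sum_norm_le.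
(* A slab holding two fifths of a dense cell cannot be thin: s >= gamma L |w j| / 5, to be compared
   with the range d |w j| L. *)
- move=> s s0 hs.
  have := @card_slab K d L w (mu - s) mu j wj0 _.
  rewrite opprB addrCA subrr addr0 => /(_ _)/wrap[]; first lra.
  move=> h.
  have h1 : 2 / 5 * #|X|%:R <= (s / `|w j| + 1) * L%:R ^+ d.-1.
    apply: le_trans hs _; apply: le_trans h; rewrite ler_nat subset_leq_card //.
    apply/subsetP => x; rewrite !inE /l => /and3P[_ h1 h2].
    by apply/andP; split; rewrite -/(lin w x); lra.
  have h2 : 2 / 5 * gamma * L%:R <= s / `|w j| + 1.
    rewrite -(ler_pM2r Lp); apply: le_trans h1; rewrite -!mulrA -Ld.
    by rewrite !(mulrA 2) ler_wpM2l ?divr_ge0.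
  have h3 : gamma * L%:R / 5 * `|w j| <= s.
    rewrite -ler_pdivlMr //; lra.
  apply: lt_le_trans (_ : gamma * 2 ^+ J * L%:R / 5 * `|w j| <= _).
    rewrite [ltLHS]mulrAC ltr_pM2r // [ltRHS]mulrAC ltr_pM2r //; lra.
  have J1 : 1 <= 2 ^+ J :> K by rewrite exprn_ege1 // ler1n.
  apply: le_trans (_ : 2 ^+ J * s <= _); last first.
    by rewrite ler_wpM2r ?(ltW s0) // exprS; lra.
  apply: le_trans (_ : 2 ^+ J * (gamma * L%:R / 5 * `|w j|) <= _); last first.
    by rewrite ler_wpM2l // exprn_ge0.
  by rewrite le_eqVlt; apply/orP; left; apply/eqP; ring.
Qed.

End CubeCenter.

(** * Helly-type theorems and deep points in the mixed-integer case *)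

(* Scarf's argument: relax the sublevel sets of a minimal infeasible subfamily
   to a maximal infeasible family [S].  Each constraint j then has a witness
   violating only j, minimally so; if two witnesses had the same parity, their
   midpoint would satisfy everything. *)
Lemma doignon_halfspaces (K : realFieldType) (F J P : finType) (par : F -> P)
    (mid : F -> F -> F) (phi : J -> F -> K) (b : J -> K) :
  (forall p q j, par p = par q -> phi j (mid p q) = (phi j p + phi j q) / 2) ->
  (forall x, exists j, b j <= phi j x) ->
  exists2 A : {set J}, (#|A| <= #|P|)%N &
    forall x, exists2 j, j \in A & b j <= phi j x.
Proof.
move=> midE infeas.
pose inf (A : {set J}) := [forall x, [exists j in A, b j <= phi j x]].
have infT : inf setT.
  apply/forallP => x; apply/exists_inP; have [j hj] := infeas x.
  by exists j; rewrite ?inE.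
have [A infA Amin] := arg_minnP (fun A : {set J} => #|A|) infT.
exists A; last by move=> x; apply/exists_inP; move/forallP: infA.
(* Admissible relaxations: each S j is a sublevel set of phi j containing the original one, and the
   S j still have no common point. *)
pose ok (S : {ffun J -> {set F}}) :=
  [&& [forall j in A, [forall x, [forall y, (x \in S j) ==> (phi j y <= phi j x) ==> (y \in S j)]]],
      [forall j in A, [forall x, (phi j x < b j) ==> (x \in S j)]]
    & [forall x, [exists j in A, x \notin S j]]].
pose S0 : {ffun J -> {set F}} := [ffun j => [set x | phi j x < b j]].
have okS0 : ok S0.
  apply/and3P; split.
  - apply/forall_inP => j _; apply/forallP => x; apply/forallP => y; rewrite ffunE !inE.
    by apply/implyP => h; apply/implyP => /le_lt_trans; apply.
  - by apply/forall_inP => j _; apply/forallP => x; rewrite ffunE inE implybb.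
  - apply/forallP => x; move/forallP: infA => /(_ x)/exists_inP[j jA h].
    by apply/exists_inP; exists j => //; rewrite ffunE inE -leNgt.
have [S /and3P[/forall_inP Sdown /forall_inP Sb /forallP Sinf] Smax] :=
  arg_maxnP (fun S : {ffun J -> {set F}} => \sum_(j in A) #|S j|)%N okS0.
have {}Sdown j x y : j \in A -> x \in S j -> phi j y <= phi j x -> y \in S j.
  by move=> /Sdown/forallP/(_ x)/forallP/(_ y)/implyP h /h/implyP.
have {}Sb j x : j \in A -> phi j x < b j -> x \in S j.
  by move=> /Sb/forallP/(_ x)/implyP.
have Sout j x y : j \in A -> x \in S j -> y \notin S j -> phi j x < phi j y.
  by move=> jA xS; rewrite ltNge; apply: contraNN; apply: Sdown.
have key j : j \in A -> exists p, [/\ p \notin S j,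
    forall k, k \in A -> k != j -> p \in S k & forall y, y \notin S j -> phi j p <= phi j y].
  move=> jA.
  have [x0 x0S] : exists x, x \notin S j.
    have : ~~ inf (A :\ j).
      by apply/negP => /Amin; rewrite (cardsD1 j A) jA /= ltnn.
    rewrite negb_forall => /existsP[x]; rewrite negb_exists_in => /forall_inP hx.
    exists x; move/(_ x)/exists_inP: Sinf => [k kA kS].
    have [<-//|kj] := eqVneq k j.
    by case/negP: kS; apply: Sb => //; rewrite ltNge hx // !inE kj.
  have x0C : x0 \in ~: S j by rewrite inE.
  case: (@arg_minP _ _ _ x0 (fun x => x \in ~: S j) (phi j) x0C) => x xC xmin.
  rewrite inE in xC.
  (* Raising S j to its next level x keeps the first two conditions of [ok]. By maximality the third
     must fail, and the common point that appears is the witness for j. *)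
  pose S' : {ffun J -> {set F}} := [ffun k => if k == j then S j :|: [set y | phi j y <= phi j x]
    else S k].
  have notok : ~~ ok S'.
    apply/negP => /Smax; rewrite /= (bigD1 j) //= [X in (_ <= X)%N](bigD1 j) //=.
    rewrite (eq_bigr (fun i => #|S i|)); last by move=> i /andP[_ ij]; rewrite ffunE (negPf ij).
    rewrite leq_add2r leqNgt => /negP; apply; rewrite ffunE eqxx.
    apply: proper_card; rewrite properE subsetUl /=; apply/subsetPn; exists x => //.
    by rewrite !inE lexx orbT.
  have [p pS'] : exists p, forall k, k \in A -> p \in S' k.
    move: notok; rewrite !negb_and => /or3P[||].
    - rewrite negb_forall_in => /exists_inP[k kA]; rewrite negb_forall => /existsP[y].
      rewrite negb_forall => /existsP[z]; rewrite ffunE; case: eqP => [->|_]; last first.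
        by rewrite !negb_imply => /and3P[h1 h2 /negP[]]; apply: Sdown h2.
      rewrite !negb_imply !inE => /and3P[/orP[h1|h1] h2 /norP[/negP h3 /negP h4]].
        by case: h3; apply: Sdown h2.
      by case: h4; apply: le_trans h1.
    - rewrite negb_forall_in => /exists_inP[k kA]; rewrite negb_forall => /existsP[y].
      rewrite negb_imply ffunE => /andP[h1].
      by case: eqP => [kj|_]; rewrite ?inE -?kj Sb.
    - rewrite negb_forall => /existsP[p]; rewrite negb_exists_in => /forall_inP h.
      by exists p => k /h; rewrite negbK.
  have pS k : k \in A -> k != j -> p \in S k.
    by move=> kA kj; have := pS' _ kA; rewrite ffunE (negPf kj).
  have pj : p \notin S j.
    move/(_ p)/exists_inP: Sinf => [k kA kS].
    by have [<-//|/(pS _ kA)] := eqVneq k j; rewrite (negPf kS).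
  exists p; split => // y yS; apply: le_trans (xmin y _); last by rewrite inE.
  by have := pS' _ jA; rewrite ffunE eqxx !inE (negPf pj).
have [->|/set0Pn[j0 /key[x0 _]]] := eqVneq A set0; first by rewrite cards0.
pose Q j p := j \in A -> [/\ p \notin S j, forall k, k \in A -> k != j -> p \in S k &
    forall y, y \notin S j -> phi j p <= phi j y].
have [p pP] : exists p : J -> F, forall j, Q j (p j).
  apply: fin_all_exists => j; rewrite /Q.
  by have [/key[p pj]|_] := boolP (j \in A); [exists p|exists x0].
suff inj : {in A &, injective (fun j => par (p j))} by rewrite -(card_in_imset inj) max_card.
move=> j k jA kA /= parE; apply/eqP; apply: contraT => jk.
have [pj1 pj2 pj3] := pP _ jA; have [pk1 pk2 pk3] := pP _ kA.
have jkj := Sout _ _ _ jA (pk2 _ jA jk) pj1.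
have jkk : phi k (p j) < phi k (p k) by apply: Sout pk1 => //; apply: pj2; rewrite // eq_sym.
(* For l = j or l = k the midpoint has a strictly smaller value than the minimal outsider of S l,
   hence lies inside. For any other l both witnesses lie in S l, and the midpoint is below the
   larger of them. *)
have /exists_inP[l lA /negP[]] := Sinf (mid (p j) (p k)).
have [->|lj] := eqVneq l j.
  apply: contraT => /pj3; rewrite midE // leNgt => /negP[]; lra.
have [->|lk] := eqVneq l k.
  apply: contraT => /pk3; rewrite midE // leNgt => /negP[]; lra.
have h1 := pj2 _ lA lj; have h2 := pk2 _ lA lk.
have [h|h] := leP (phi l (p j)) (phi l (p k)).
  by apply: Sdown h2 _ => //; rewrite midE //; lra.
by apply: Sdown h1 _ => //; rewrite midE //; lra.
Qed.

Section Helly.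
Variables (K : realFieldType) (d : nat).

(** Points of weight zero are exempt, so that [helly] can keep in the sum the one point not known to
    lie in the set. *)
Definition convex_pred (C : 'rV[K]_d -> Prop) :=
  forall m (lam : 'I_m -> K) (y : 'I_m -> 'rV[K]_d), (forall i, 0 <= lam i) ->
    \sum_i lam i = 1 -> (forall i, lam i != 0 -> C (y i)) ->
    C (\sum_i lam i *: y i).

(** The rows (1, y i) have length d + 1 < m, so they are dependent; replacing the relation by its
    opposite if necessary makes some coefficient positive. *)
Lemma affine_dependence m (y : 'I_m -> 'rV[K]_d) : (d.+1 < m)%N ->
  exists mu : 'I_m -> K, [/\ exists i, 0 < mu i, \sum_i mu i = 0 &
     \sum_i mu i *: y i = 0].
Proof.
move=> dm; pose B : 'M[K]_(m, 1 + d) := \matrix_i row_mx 1 (y i).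
have : kermx B != 0.
  rewrite kermx_eq0 /row_free; apply: contraL dm => /eqP <-; rewrite -leqNgt.
  exact: rank_leq_col.
case/rowV0Pn => v vB v0; have /sub_kermxP vB0 := vB.
have sums (u : 'rV[K]_m) : u *m B = 0 ->
    \sum_i u 0 i = 0 /\ \sum_i u 0 i *: y i = 0.
  move=> uB; have : u *m B = row_mx (\sum_i (u 0 i)%:M) (\sum_i u 0 i *: y i).
    rewrite mulmx_sum_row; rewrite -[RHS]hsubmxK row_mxKl row_mxKr.
    have -> : \sum_i u 0 i *: row i B = \sum_i row_mx (u 0 i)%:M (u 0 i *: y i).
      apply: eq_bigr => i _; rewrite rowK scale_row_mx; congr row_mx.
      by rewrite -[1]/(1%:M) scale_scalar_mx mulr1.
    elim/big_rec3 : _ => [|i a b c _ ->]; first by rewrite row_mx0.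
    by rewrite add_row_mx.
  rewrite uB -row_mx0 => /eq_row_mx[/esym h1 /esym h2]; split => //.
  by move/matrixP/(_ 0 0): h1; rewrite -(raddf_sum (@scalar_mx K 1)) !mxE eqxx mulr1n.
have [i vi] : exists i, v 0 i != 0.
  apply/existsP; rewrite -negb_forall; apply: contraNN v0 => /forallP h.
  by apply/eqP/rowP => i; rewrite mxE; apply/eqP; rewrite -[_ == _]negbK h.
case: (ltrgt0P (v 0 i)) => [vp|vn|v00]; last by rewrite v00 eqxx in vi.
  by exists (fun i => v 0 i); have [h1 h2] := sums _ vB0; split => //; exists i.
exists (fun i => (- v) 0 i); have [|h1 h2] := sums (- v); first by rewrite mulNmx vB0 oppr0.
by split => //; exists i; rewrite mxE oppr_gt0.
Qed.

(** Radon's argument. Leaving out the set j gives a point y j in all the others. An affine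
    dependence writes one point z as a convex combination of the y j with positive coefficient and
    also of the remaining ones. For each k, one of these two expressions avoids y k, so z lies in C
    k. *)
Lemma helly m (C : 'I_m -> 'rV[K]_d -> Prop) :
  (forall j, convex_pred (C j)) ->
  (forall A : {set 'I_m}, (#|A| <= d.+1)%N -> exists y, forall j, j \in A -> C j y) ->
  exists y, forall j, C j y.
Proof.
elim: m C => [|m IH] C convC small.
  by exists 0 => -[].
have [md|md] := leqP m d.
  have [|y yC] := small setT; first by rewrite cardsT card_ord.
  by exists y => j; apply: yC.
pose Q (j : 'I_m.+1) y := forall k, k != j -> C k y.
have [y yC] : exists y, forall j, Q j (y j).
  apply: fin_all_exists => j.
  have [//|A sA|y yC] := IH (fun k => C (lift j k)).
    have [|y yC] := small [set lift j k | k in A].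
      by rewrite card_imset //; apply: lift_inj.
    by exists y => k kA; apply: yC; apply: imset_f.
  exists y => k kj; have := yC; rewrite eq_sym in kj.
  by case/unlift_some: kj => k' -> _ => /(_ k').
have [//|mu [[i0 mu0] smu smuy]] := @affine_dependence m.+1 y.
pose s := \sum_(i | 0 < mu i) mu i.
have s0 : 0 < s.
  rewrite /s (bigD1 i0) //= ltr_pwDl //; apply: sumr_ge0 => i /andP[/ltW //].
have sN : \sum_(i | ~~ (0 < mu i)) - mu i = s.
  move: smu; rewrite (bigID (fun i => 0 < mu i)) /= -/s => /eqP.
  by rewrite addr_eq0 sumrN => /eqP ->.
pose z := \sum_i ((if 0 < mu i then mu i else 0) / s) *: y i.
have zE : z = \sum_i ((if 0 < mu i then 0 else - mu i) / s) *: y i.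
  apply/eqP; rewrite -subr_eq0 /z -sumrB (eq_bigr (fun i => s^-1 *: (mu i *: y i))).
    by rewrite -scaler_sumr smuy scaler0.
  move=> i _; rewrite -scalerBl scalerA; congr (_ *: _).
  by case: ifP => _; rewrite mul0r ?subr0 ?sub0r -?mulNr ?opprK mulrC.
exists z => k; have [muk|muk] := ltP 0 (mu k).
  rewrite zE; apply: convC => [i||i].
  - by case: ifP => [_|/negbT]; rewrite ?mul0r // -leNgt => h; rewrite divr_ge0 ?oppr_ge0 // ltW.
  - rewrite -mulr_suml (_ : \sum_i _ = s) ?divff ?gt_eqF //.
    by rewrite -[RHS]sN [RHS]big_mkcond /=; apply: eq_bigr => i _; case: ifP.
  - by have [->|ki _] := eqVneq i k; [rewrite muk mul0r eqxx|apply: yC; rewrite eq_sym].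
apply: convC => [i||i].
- by case: ifP => [h|_]; rewrite ?mul0r // divr_ge0 // ltW.
- by rewrite -mulr_suml (_ : \sum_i _ = s) ?divff ?gt_eqF // /s [RHS]big_mkcond.
- have [->|ki _] := eqVneq i k; last by apply: yC; rewrite eq_sym.
  by rewrite ltNge muk mul0r eqxx.
Qed.

End Helly.

(** * Separation from the convex hull of finitely many points *)

Section Dot.
Variables (K : realType) (m : nat).
Implicit Types u v w : 'rV[K]_m.

Lemma dotC u v : dot u v = dot v u.
Proof. by apply: eq_bigr => i _; rewrite mulrC. Qed.

Lemma dotDr u v w : dot u (v + w) = dot u v + dot u w.
Proof. by rewrite /dot -big_split; apply: eq_bigr => i _; rewrite mxE mulrDr. Qed.

Lemma dotZr (a : K) u v : dot u (a *: v) = a * dot u v.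
Proof. by rewrite /dot mulr_sumr; apply: eq_bigr => i _; rewrite mxE mulrCA. Qed.

Lemma dotNr u v : dot u (- v) = - dot u v.
Proof. by rewrite -scaleN1r dotZr mulN1r. Qed.

Lemma dotBr u v w : dot u (v - w) = dot u v - dot u w.
Proof. by rewrite dotDr dotNr. Qed.

Lemma dot0r u : dot u 0 = 0.
Proof. by rewrite -(scale0r 0) dotZr mul0r. Qed.

Lemma dot_sumr (I : finType) (P : pred I) u (F : I -> 'rV[K]_m) :
  dot u (\sum_(i | P i) F i) = \sum_(i | P i) dot u (F i).
Proof. by elim/big_rec2 : _ => [|i a b _ <-]; rewrite ?dot0r ?dotDr. Qed.

Lemma dot_line u v (e : K) :
  dot (u + e *: v) (u + e *: v) = dot u u + e * (2 * dot u v + e * dot v v).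
Proof. by rewrite dotDr dotZr !(dotC (u + _)) !dotDr !dotZr (dotC v u); ring. Qed.

Lemma dot_ge0 u : 0 <= dot u u.
Proof. by apply: sumr_ge0 => i _; rewrite -expr2 sqr_ge0. Qed.

Lemma dot_eq0 u : (dot u u == 0) = (u == 0).
Proof.
apply/eqP/eqP => [u0|->]; last exact: dot0r.
apply/rowP => i; rewrite mxE; apply/eqP; rewrite -sqrf_eq0 eq_le sqr_ge0 andbT -u0.
rewrite /dot (bigD1 i) //= -expr2 lerDl sumr_ge0 // => j _.
by rewrite -expr2 sqr_ge0.
Qed.

End Dot.

Section Norm.
Variables (K : realType) (m : nat).
Implicit Types z : 'rV[K]_m.

Lemma rV_normP z (R : K) : 0 <= R -> (`|z| <= R) <-> (forall i, `|z 0 i| <= R).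
Proof.
move=> R0; rewrite [`|z|]mx_normrE; split=> [h i|h].
  by apply: le_trans h; rewrite (le_bigmax _ (fun ij => `|z ij.1 ij.2|) (0, i)).
by apply/bigmax_leP; split => // -[i j] _ /=; rewrite ord1.
Qed.

End Norm.

Definition hull (K : realType) (T : finType) (m : nat) (p : T -> 'rV[K]_m)
    (W : {set T}) (x : 'rV[K]_m) : Prop :=
  exists lam : T -> K, [/\ forall t, 0 <= lam t, forall t, t \notin W -> lam t = 0,
    \sum_t lam t = 1 & \sum_t lam t *: p t = x].

Section Hull.
Variables (K : realType) (T : finType) (m : nat) (p : T -> 'rV[K]_m).

Lemma hull_conv (W : {set T}) : forall k (lam : 'I_k -> K) (y : 'I_k -> 'rV[K]_m),
  (forall i, 0 <= lam i) -> \sum_i lam i = 1 ->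
  (forall i, lam i != 0 -> hull p W (y i)) -> hull p W (\sum_i lam i *: y i).
Proof.
move=> k lam y lam0 lam1 hy.
pose Q (i : 'I_k) (mu : T -> K) := lam i != 0 -> [/\ forall t, 0 <= mu t,
  forall t, t \notin W -> mu t = 0, \sum_t mu t = 1 & \sum_t mu t *: p t = y i].
have [mu muP] : exists mu, forall i, Q i (mu i).
  apply: fin_all_exists => i; rewrite /Q.
  by have [|/hy[mu muP]] := eqVneq (lam i) 0; [exists (fun=> 0)|exists mu].
exists (fun t => \sum_i lam i * mu i t); split.
- move=> t; apply: sumr_ge0 => i _; have [->|h] := eqVneq (lam i) 0; first by rewrite mul0r.
  by rewrite mulr_ge0 //; case: (muP i h).
- move=> t tW; apply: big1 => i _; have [->|h] := eqVneq (lam i) 0; first by rewrite mul0r.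
  by case: (muP i h) => _ -> //; rewrite mulr0.
- rewrite exchange_big /= -[RHS]lam1; apply: eq_bigr => i _; rewrite -mulr_sumr.
  have [->|h] := eqVneq (lam i) 0; first by rewrite mul0r.
  by case: (muP i h) => _ _ -> _; rewrite mulr1.
- rewrite (eq_bigr (fun t => \sum_i lam i *: (mu i t *: p t))); last first.
    by move=> t _; rewrite scaler_suml; apply: eq_bigr => i _; rewrite scalerA.
  rewrite exchange_big /=; apply: eq_bigr => i _; rewrite -scaler_sumr.
  have [->|h] := eqVneq (lam i) 0; first by rewrite !scale0r.
  by case: (muP i h) => _ _ _ ->.
Qed.

Lemma hull_halfspace (W : {set T}) x (g : 'rV[K]_m) (b : K) : hull p W x ->
  (forall t, t \in W -> dot g (p t) < b) -> dot g x < b.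
Proof.
move=> [lam [lam0 lamW lam1 <-]] gb; rewrite dot_sumr.
rewrite -[b]mul1r -lam1 mulr_suml -subr_gt0 -sumrB.
have [t lt] : exists t, lam t != 0.
  apply/existsP; apply: contraT; rewrite negb_exists => /forallP h.
  move: lam1; rewrite big1 => [/eqP|t _]; first by rewrite eq_sym oner_eq0.
  by apply/eqP; rewrite -[_ == _]negbK h.
have tW : t \in W by apply: contraNT lt => /lamW ->.
have pos s : 0 <= lam s * b - dot g (lam s *: p s).
  rewrite dotZr -mulrBr; have [/gb h|/lamW ->] := boolP (s \in W); last by rewrite mul0r.
  by rewrite mulr_ge0 // subr_ge0 ltW.
rewrite (bigD1 t) //= ltr_pwDl ?sumr_ge0 //.
by rewrite dotZr -mulrBr mulr_gt0 ?subr_gt0 ?gb // lt0r lt lam0.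
Qed.

Lemma hull_norm (W : {set T}) x (R : K) : 0 <= R -> hull p W x ->
  (forall t, t \in W -> `|p t| <= R) -> `|x| <= R.
Proof.
move=> R0 [lam [lam0 lamW lam1 <-]] pR.
apply: le_trans (ler_norm_sum _ _ _) _; rewrite -[R]mul1r -lam1 mulr_suml.
apply: ler_sum => t _; rewrite normrZ ger0_norm //.
by have [/pR h|/lamW ->] := boolP (t \in W); [rewrite ler_wpM2l|rewrite !mul0r].
Qed.

Local Open Scope classical_set_scope.

Lemma sum_continuous (U : topologicalType) (I : finType) (F : I -> U -> K) :
  (forall i, continuous (F i)) -> continuous (fun u => \sum_i F i u).
Proof.
move=> cF u; rewrite (_ : (fun u => _) = \sum_i F i); last first.
  by apply/funext => v; rewrite fct_sumE.
elim/big_ind : _ => [|f g cf cg|i _]; [exact: cst_continuous|exact: continuousD|exact: cF].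
Qed.

(* The normal is read off the point of the hull closest to x. *)
Lemma hull_separation (W : {set T}) x : ~ hull p W x ->
  exists a : 'rV[K]_m, forall t, t \in W -> dot a (p t) < dot a x.
Proof.
move=> xW; have [->|/set0Pn[t0 t0W]] := eqVneq W finset.set0.
  by exists 0 => t; rewrite inE.
pose N := #|T|; pose lamb (v : 'rV[K]_N) t := v 0 (enum_rank t).
pose vec (v : 'rV[K]_N) := \sum_t lamb v t *: p t - x.
pose f v := dot (vec v) (vec v).
pose S : set 'rV[K]_N := \bigcap_t [set v | 0 <= lamb v t] `&`
   \bigcap_(t in [set t | t \notin W]) [set v | lamb v t = 0] `&` [set v | \sum_t lamb v t = 1].
have clamb t : continuous (fun v => lamb v t) by apply: coord_continuous.
pose ev (mu : T -> K) : 'rV[K]_N := \row_i mu (enum_val i).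
have lambE mu : lamb (ev mu) = mu.
  by apply/funext => t; rewrite /lamb mxE enum_rankK.
have S0 : S !=set0.
  exists (ev (fun t => (t == t0)%:R)); split; [split|].
  - by move=> t _ /=; rewrite lambE.
  - move=> t /= tW; rewrite lambE; case: eqP tW => // ->; by rewrite t0W.
  - rewrite /= lambE (bigD1 t0) //= eqxx big1 ?addr0 // => t /negPf->//.
have Scl : closed S.
  apply: closedI; first apply: closedI.
  - apply: closed_bigI => t _; apply: (@preimage_closed _ _ (fun v => lamb v t) [set y | 0 <= y]).
      by move=> v _; apply: clamb.
    exact: closed_ge.
  - apply: closed_bigI => t _; apply: (@preimage_closed _ _ (fun v => lamb v t) [set y | y = 0]).
      by move=> v _; apply: clamb.
    exact: closed_eq.
  - apply: (@preimage_closed _ _ (fun v => \sum_t lamb v t) [set y | y = 1]).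
      by move=> v _; apply: sum_continuous.
    exact: closed_eq.
have Sbd : bounded_set S.
  exists 1; split => // M M1 v [[v0 _] v1] /=.
  have M0 : 0 <= M by apply: le_trans (ltW M1).
  apply/(rV_normP _ M0) => i; apply: le_trans (ltW M1).
  rewrite -(enum_valK i) ger0_norm; last exact: v0.
  rewrite -[X in _ <= X]v1 (bigD1 (enum_val i)) //= lerDl.
  by apply: sumr_ge0 => t _; apply: v0.
have cf : continuous f.
  apply: sum_continuous => j; have cj : continuous (fun v => vec v 0 j).
    rewrite (_ : (fun v => _) = (fun v => \sum_t lamb v t * p t 0 j - x 0 j)); last first.
      apply/funext => v; rewrite /vec !mxE summxE; congr (_ - _).
      by apply: eq_bigr => t _; rewrite mxE.
    move=> v; apply: continuousB; last exact: cst_continuous.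
    apply: sum_continuous => t w; apply: continuousM; [exact: clamb|exact: cst_continuous].
  by move=> v; apply: continuousM; apply: cj.
have [v vS vmin] := EVT_min_rV S0 (bounded_closed_compact Sbd Scl) (continuous_subspaceT cf).
move/set_mem: vS => [[/= v0 vW] v1].
set q := vec v.
have q0 : 0 < dot q q.
  rewrite lt0r dot_ge0 andbT dot_eq0; apply/eqP => qE; apply: xW.
  exists (lamb v); split => //; first by move=> t; apply: v0.
  by apply/eqP; rewrite -subr_eq0; apply/eqP.
exists (- q) => s sW; rewrite dotC dotNr [ltRHS]dotC dotNr ltrN2 -subr_gt0 ![dot _ q]dotC -dotBr.
have step (e : K) : 0 < e -> e <= 1 ->
    0 <= 2 * dot q (p s - x - q) + e * dot (p s - x - q) (p s - x - q).
  move=> e0 e1; pose w := ev (fun t => (1 - e) * lamb v t + e * (t == s)%:R).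
  have wS : w \in S.
    apply/mem_set; split; [split|] => /=.
    - move=> t _ /=; rewrite /w lambE addr_ge0 // mulr_ge0 ?subr_ge0 ?ler0n ?(ltW e0) //.
      exact: v0.
    - move=> t /= tW; rewrite /w lambE vW // mulr0 add0r.
      by case: eqP tW => [->|_ _]; rewrite ?sW ?mulr0.
    - rewrite /w lambE big_split /= -!mulr_sumr v1 (bigD1 s) //= eqxx big1 ?addr0 ?mulr1 ?subrK //.
      by move=> t /negPf->.
  have := vmin w wS; rewrite /f.
  have -> : vec w = q + e *: (p s - x - q).
    rewrite /vec /w lambE.
    rewrite (eq_bigr (fun t => (1 - e) *: (lamb v t *: p t) + e *: ((t == s)%:R *: p t))); last first.
      by move=> t _ /=; rewrite !scalerA -scalerDl.
    rewrite big_split /= -!scaler_sumr [X in _ + e *: X](bigD1 s) //= eqxx scale1r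
      [X in _ + e *: (_ + X)]big1 ?addr0; last first.
      by move=> t /negPf->; rewrite scale0r.
    have -> : \sum_t lamb v t *: p t = q + x by rewrite /q /vec subrK.
    apply/rowP => j; rewrite !mxE; ring.
  by rewrite -/q dot_line lerDl pmulr_rge0.
(* First-order optimality of the closest point in the direction of p s. If the slope a were
   negative, the chosen e gives e b <= - a, so 2 a + e b <= a < 0 contradicts [step]. *)
have h0 : 0 <= dot q (p s - x - q).
  rewrite leNgt; apply/negP => neg.
  set a := dot q _ in step neg; set b := dot (p s - x - q) _ in step.
  have b0 : 0 <= b by apply: dot_ge0.
  pose e := Num.min 1 (- a / (b + 1)).
  have e0 : 0 < e by rewrite lt_min ltr01 divr_gt0 ?oppr_gt0 // ltr_wpDl.
  have e1 : e <= 1 by rewrite ge_min lexx.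
  have : e * (b + 1) <= - a by rewrite -ler_pdivlMr ?ltr_wpDl // ge_min lexx orbT.
  have := step e e0 e1; lra.
rewrite dotBr in h0; lra.
Qed.

End Hull.

Section MixedCenter.
Variables (K : realType) (n d r : nat).
Local Notation F := {ffun 'I_n -> 'I_(r.*2).+1}.

Definition lattice_point (x : F) : 'rV[K]_n := \row_i ((x i)%:R - r%:R).

Lemma lattice_point_integral x : Defs.integral (lattice_point x).
Proof.
apply/mxOverP => i j; rewrite mxE rpredB //; exact: natr_int.
Qed.

Lemma lattice_point_norm x : `|lattice_point x| <= r%:R.
Proof.
apply/rV_normP => // i; rewrite mxE ler_norml lerBrDr lerBlDr addNr ler0n /=.
by rewrite -natrD ler_nat addnn -ltnS.
Qed.

Definition parity (x : F) : {ffun 'I_n -> bool} := [ffun i => odd (x i)].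

(** The half sum always stays in range, so [inord] never takes its default value. For points of
    equal parity no rounding occurs. *)
Definition midpoint (x y : F) : F := [ffun i => inord ((x i + y i)./2)].

Lemma dot_midpoint (a : 'rV[K]_n) x y : parity x = parity y ->
  dot a (lattice_point (midpoint x y)) =
  (dot a (lattice_point x) + dot a (lattice_point y)) / 2.
Proof.
move=> /ffunP xy; rewrite /dot -big_split /= mulr_suml; apply: eq_bigr => i _.
rewrite !mxE ffunE inordK; last first.
  by have := ltn_ord (x i); have := ltn_ord (y i); lia.
have := odd_double_half (x i + y i); have := xy i; rewrite !ffunE oddD => ->.
rewrite addbb add0n => h.
have : (x i)%:R + (y i)%:R = (x i + y i)./2%:R * 2 :> K by rewrite -natrM -natrD muln2 h.
set u := _./2; move=> e; have -> : (x i)%:R = u%:R * 2 - (y i)%:R :> K by rewrite -e addrK.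
by field.
Qed.

Variables (T : finType) (R : K) (pos : T -> 'rV[K]_(n + d)) (ix : T -> F).
Hypotheses (rR : r%:R <= R) (posl : forall t, lsubmx (pos t) = lattice_point (ix t))
  (posR : forall t, `|pos t| <= R).

(** The same weights, applied to the continuous components, lift the combination. *)
Lemma fiber_hull (W : {set T}) x :
  hull (fun t => lattice_point (ix t)) W x -> exists y, hull pos W (row_mx x y).
Proof.
move=> [lam [lam0 lamW lam1 <-]]; exists (\sum_t lam t *: rsubmx (pos t)).
exists lam; split => //; rewrite -[LHS]hsubmxK; congr row_mx.
  rewrite (raddf_sum (@lsubmx K 1 n d)); apply: eq_bigr => t _.
  by apply/rowP => j; rewrite -posl !mxE.
rewrite (raddf_sum (@rsubmx K 1 n d)); apply: eq_bigr => t _.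
by apply/rowP => j; rewrite !mxE.
Qed.

Lemma hullS (W W' : {set T}) (m : nat) (p : T -> 'rV[K]_m) x :
  W \subset W' -> hull p W x -> hull p W' x.
Proof.
move=> /subsetP sW [lam [lam0 lamW lam1 lamx]]; exists lam; split => // t tW.
by apply: lamW; apply: contraNN tW; apply: sW.
Qed.

(* Suppose every z has a normal whose cut is light.  The sets KK of points kept
   by light cuts cannot all have hulls meeting the fiber over a lattice point x
   in a common point; by Helly, d+1 of them already do not, so x is separated
   in R^n from their intersection, which misses at most d+1 light cuts.  Doignon's
   theorem applied to these separating halfspaces covers Y by 2^n such sets. *)
Lemma mixed_center (Y : {set T}) : exists z, [/\ box R z, Defs.integral (lsubmx z) &
  forall g, (#|Y| <= 2 ^ n * d.+1 * #|[set t in Y | (dot g z <= dot g (pos t))%R]|)%N].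
Proof.
have R0 : 0 <= R by apply: le_trans rR.
pose cut g z := [set t in Y | dot g z <= dot g (pos t)].
pose H := (2 ^ n * d.+1)%N.
apply: contrapT => noz.
have bad z : box R z -> Defs.integral (lsubmx z) -> exists g, (H * #|cut g z| < #|Y|)%N.
  move=> zR zI; apply: contrapT => nog; apply: noz; exists z; split => // g.
  by rewrite leqNgt; apply/negP => h; apply: nog; exists g.
have Y0 : (0 < #|Y|)%N.
  have [||g] := bad 0; last by apply: leq_ltn_trans.
    by rewrite /box /= normr0.
  by rewrite linear0; apply/mxOverP => i j; rewrite mxE.
have sep (x : F) : exists a : 'rV[K]_n,
    (2 ^ n * #|[set t in Y | (dot a (lattice_point x) <= dot a (lattice_point (ix t)))%R]|
      <= #|Y|.-1)%N.
  pose KK := [set W : {set T} | (W \subset Y) && (H * #|Y :\: W| < #|Y|)%N].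
  pose S (j : 'I_#|KK|) : {set T} := enum_val j.
  pose C (j : 'I_#|KK|) y := hull pos (S j) (row_mx (lattice_point x) y).
  have KKP j : S j \subset Y /\ (H * #|Y :\: S j| < #|Y|)%N.
    by apply/andP; have := enum_valP (A := mem KK) j; rewrite inE.
  have convC j : convex_pred (C j).
    move=> k lam y lam0 lam1 Cy; rewrite /C.
    have -> : row_mx (lattice_point x) (\sum_i lam i *: y i) =
        \sum_i lam i *: row_mx (lattice_point x) (y i).
      apply/rowP => q; rewrite summxE [LHS]mxE.
      under [RHS]eq_bigr do rewrite !mxE.
      case: (split q) => q'; first by rewrite -mulr_suml lam1 mul1r.
      by rewrite summxE; apply: eq_bigr => i _; rewrite mxE.
    exact: hull_conv.
  (* A common point y would give a point z in every hull. Y itself belongs to KK, so z is in the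
     box; then the light cut of its bad normal g belongs to KK after complementation, and z in that
     hull yields dot g z < dot g z. *)
  have noC : ~ exists y, forall j, C j y.
    move=> [y yC].
    have YK : Y \in KK by rewrite inE subxx setDv cards0 muln0.
    have := yC (enum_rank_in YK Y); rewrite /C /S enum_rankK_in // => yY.
    pose z := row_mx (lattice_point x) y.
    have [||g hg] := bad z.
    - by apply: (hull_norm R0 yY) => t _; apply: posR.
    - by rewrite row_mxKl; apply: lattice_point_integral.
    have WK : Y :\: cut g z \in KK.
      rewrite inE subsetDl /=; congr (_ < _)%N: hg; congr (_ * _)%N.
      by apply: eq_card => t; rewrite !inE; case: (t \in Y); case: (_ <= _)%R.
    have := yC (enum_rank_in WK (Y :\: cut g z)); rewrite /C /S enum_rankK_in // => yW.
    suff : dot g z < dot g z by rewrite ltxx.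
    apply: hull_halfspace yW _ => t.
    by rewrite !inE => /andP[+ tY]; rewrite tY -ltNge.
  have [A sA noA] : exists2 A : {set 'I_#|KK|}, (#|A| <= d.+1)%N &
      ~ exists y, forall j, j \in A -> C j y.
    apply: contrapT => h; apply: noC; apply: (helly convC) => A sA.
    by apply: contrapT => noA; apply: h; exists A.
  pose W := Y :&: \bigcap_(j in A) S j.
  have xW : ~ hull (fun t => lattice_point (ix t)) W (lattice_point x).
    move=> /fiber_hull[y yW]; apply: noA; exists y => j jA.
    apply: hullS yW; apply: subset_trans (subsetIr _ _) _; exact: bigcap_inf.
  have [a aW] := hull_separation xW; exists a.
  set Z := [set t in Y | _].
  have ZU : Z \subset \bigcup_(j in A) (Y :\: S j).
    apply/subsetP => t; rewrite inE => /andP[tY ta]; apply/bigcupP.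
    have : t \notin W by apply/negP => /aW; rewrite ltNge ta.
    rewrite inE tY /= => /bigcapP h; apply: contrapT => h'; apply: h => j jA.
    by apply: contrapT => /negP tj; apply: h'; exists j => //; rewrite inE tj.
  have cZ : (#|Z| <= \sum_(j in A) #|Y :\: S j|)%N.
    apply: leq_trans (subset_leq_card ZU) _.
    elim/big_rec2 : _ => [|j s B _ IH]; first by rewrite cards0.
    by apply: leq_trans (leq_card_setU _ _) _; rewrite leq_add2l.
  (* Each complement satisfies H |Y \ S j| <= |Y| - 1. The predecessor keeps the inequality strict
     until the final count, and the factor d + 1 of H cancels the number of sets. *)
  have : (H * #|Z| <= d.+1 * #|Y|.-1)%N.
    apply: leq_trans (_ : #|A| * #|Y|.-1 <= _)%N; last by rewrite leq_mul2r sA orbT.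
    apply: leq_trans (_ : H * \sum_(j in A) #|Y :\: S j| <= _)%N; first by rewrite leq_mul2l cZ orbT.
    rewrite big_distrr /= -sum_nat_const leq_sum // => j _.
    by have [_] := KKP j; rewrite -{1}(prednK Y0) ltnS.
  by rewrite /H mulnAC mulnC leq_pmul2l.
pose Q (x : F) (a : 'rV[K]_n) : Prop := (2 ^ n *
    #|[set t in Y | (dot a (lattice_point x) <= dot a (lattice_point (ix t)))%R]|
      <= #|Y|.-1)%N.
have [a aP] : exists a : F -> 'rV[K]_n, forall x, Q x (a x) by exact: (fin_all_exists sep).
(* The halfspaces phi j < phi j j each exclude their own lattice point j, so no lattice point
   satisfies all of them. *)
pose phi j x := dot (a j) (lattice_point x).
have [|x|A sA hA] := @doignon_halfspaces K F F _ parity midpoint phi (fun j => phi j j).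
- by move=> p q j; apply: dot_midpoint.
- by exists x.
pose Z j := [set t in Y | phi j j <= phi j (ix t)].
have YU : Y \subset \bigcup_(j in A) Z j.
  apply/subsetP => t tY; have [j jA h] := hA (ix t).
  by apply/bigcupP; exists j => //; rewrite inE tY.
have cY : (#|Y| <= \sum_(j in A) #|Z j|)%N.
  apply: leq_trans (subset_leq_card YU) _.
  elim/big_rec2 : _ => [|j s B _ IH]; first by rewrite cards0.
  by apply: leq_trans (leq_card_setU _ _) _; rewrite leq_add2l.
have : (2 ^ n * #|Y| <= 2 ^ n * #|Y|.-1)%N.
  apply: leq_trans (_ : #|A| * #|Y|.-1 <= _)%N; last first.
    by move: sA; rewrite card_ffun card_bool card_ord leq_mul2r => ->; rewrite orbT.
  apply: leq_trans (_ : 2 ^ n * \sum_(j in A) #|Z j| <= _)%N; first by rewrite leq_mul2l cY orbT.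
  by rewrite big_distrr /= -sum_nat_const leq_sum // => j _; apply: aP.
by rewrite leq_pmul2l ?expn_gt0 // -{1}(prednK Y0) ltnn.
Qed.

End MixedCenter.

(** * Learning responses with binary queries *)

Section Trees.
Variables (K : realType) (inst S : Type) (Q : oracle inst bool).
Variables (sol : inst -> set S) (J : finType) (ev : J -> inst).
Implicit Types (A : {set J}) (q : query inst bool).

(** A decision tree of depth k for the instances in A, all instances at a leaf having a common
    acceptable output. Sets of candidates replace histories until [solvable_strategy]. *)
Fixpoint solvable (k : nat) A : Prop :=
  if k is k'.+1 then
    exists2 q, Q q & forall b, solvable k' [set j in A | q (ev j) == b]
  else exists z, forall j, j \in A -> sol (ev j) z.

Lemma solvableS k A A' : A' \subset A -> solvable k A -> solvable k A'.
Proof.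
elim: k A A' => [|k IH] A A' /subsetP sA /=.
  by move=> [z zA]; exists z => j /sA/zA.
move=> [q Qq qA]; exists q => // b; apply: IH (qA b).
by apply/subsetP => j; rewrite !inE => /andP[/sA -> ->].
Qed.

Variable q0 : query inst bool.
Hypothesis Qq0 : Q q0.

Lemma leq_solvable k k' A : (k <= k')%N -> solvable k A -> solvable k' A.
Proof.
move=> /subnK <-; elim: (k' - k)%N => //= m IH /IH {IH}.
elim: (m + k)%N A => [|l IH] A.
  by move=> [z zA]; exists q0 => // b; exists z => j; rewrite inE => /andP[/zA].
by move=> [q Qq qA]; exists q => // b; apply: IH; apply: qA.
Qed.

Lemma solvable_strategy k A : solvable k A ->
  exists2 D, query_strategy Q D &
    exists out : history inst bool -> S, forall j, j \in A ->
      sol (ev j) (out (transcript D (ev j) k)).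
Proof.
elim: k A => [|k IH] A /=.
  by move=> [z zA]; exists (fun=> q0) => //; exists (fun=> z).
move=> [q Qq qA].
have [DT DTQ [outT outTP]] := IH _ (qA true).
have [DF DFQ [outF outFP]] := IH _ (qA false).
pose D (s : history inst bool) :=
  if s is p :: s' then (if p.2 then DT s' else DF s') else q.
have DE i l : transcript D i l.+1 =
    (q, q i) :: transcript (if q i then DT else DF) i l.
  elim: l => [|l IHl] //; rewrite [LHS]/= -/(transcript D i l.+1) IHl rcons_cons.
  by rewrite /D /=; case: (q i).
exists D; first by move=> [|p s] //=; case: p.2.
exists (fun s => if s is p :: s' then (if p.2 then outT s' else outF s') else outT s).
move=> j jA; rewrite -[rcons _ _]/(transcript D (ev j) k.+1) DE /=.
by case qj: (q (ev j)); [apply: outTP|apply: outFP]; rewrite inE jA qj.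
Qed.

Definition cost_le (r : K) A := exists2 k, k%:R <= r & solvable k A.

Lemma cost_leW r r' A : r <= r' -> cost_le r A -> cost_le r' A.
Proof. by move=> rr' [k kr sk]; exists k => //; apply: le_trans rr'. Qed.

Lemma cost_le_node q r A : Q q -> (forall b, cost_le r [set j in A | q (ev j) == b]) ->
  cost_le (r + 1) A.
Proof.
move=> Qq h; have [k1 kr1 s1] := h true; have [k2 kr2 s2] := h false.
exists (maxn k1 k2).+1.
  by rewrite -natr1 lerD2r; case: (leqP k1 k2).
by exists q => // -[]; [apply: leq_solvable s1|apply: leq_solvable s2];
  rewrite ?leq_maxl ?leq_maxr.
Qed.

(** Since exp(1/3) <= 3/2, a query that leaves at most two thirds of the instances is paid for by
    the decrease of 3 ln |A|. This is the origin of the coefficient 3. *)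
Lemma ln_two_thirds (a b : nat) : (0 < a)%N -> (3 * a <= 2 * b)%N ->
  3 * ln a%:R + 1 <= 3 * ln b%:R :> K.
Proof.
move=> a0 ab; have b0 : (0 < b)%N by lia.
have e3 : expR (1 / 3) <= 3 / 2 :> K.
  have h : 2 / 3 <= expR (- (1 / 3)) :> K by apply: le_trans (expR_ge1Dx _); lra.
  have p : 0 < expR (1 / 3) :> K by apply: expR_gt0.
  rewrite expRN in h.
  have : 2 / 3 * expR (1 / 3) <= 1 :> K by rewrite -ler_pdivlMr // [leRHS]mul1r.
  lra.
have : ln (a%:R * expR (1 / 3)) <= ln b%:R :> K.
  rewrite ler_ln ?posrE ?mulr_gt0 ?ltr0n ?expR_gt0 //.
  apply: le_trans (_ : a%:R * (3 / 2) <= _); first by rewrite ler_wpM2l.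
  have : (3 * a)%:R <= (2 * b)%:R :> K by rewrite ler_nat.
  rewrite !natrM; lra.
rewrite lnM ?posrE ?ltr0n ?expR_gt0 // expRK; lra.
Qed.

(* U is a minimal union of response classes with at least a third of A.  Either
   U is balanced, or dropping one class from U loses more than a third of A, and
   then that class is asked for. *)
Lemma cost_le_learn (V : Type) (rho : inst -> V) :
  (forall h : V -> bool, Q (fun i => h (rho i))) ->
  forall (A : {set J}) (r : K), 0 <= r ->
  (forall A' : {set J}, A' \subset A ->
     (forall j j', j \in A' -> j' \in A' -> rho (ev j) = rho (ev j')) ->
     cost_le (3 * ln #|A'|%:R + r) A') ->
  cost_le (3 * ln #|A|%:R + (r + 1)) A.
Proof.
move=> Qrho A r r0; have [m] := ubnP #|A|; elim: m A => // m IH A ltA const.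
have lnn (a : nat) : 0 <= ln a%:R :> K.
  by case: a => [|a]; [rewrite ln0|rewrite ln_ge0 // ler1n].
have [A0|/set0Pn[j1 j1A]] := eqVneq A set0.
  apply: cost_leW (const A _ _) => //; first by rewrite addrA lerDl.
  by move=> j j'; rewrite A0 inE.
pose sat (U : {set J}) := [&& U \subset A,
   `[< forall j j', j \in U -> j' \in A -> rho (ev j) = rho (ev j') -> j' \in U >]
   & (#|A| <= 3 * #|U|)%N].
have satA : sat A.
  by apply/and3P; split => //; [apply/asboolP|lia].
have [U /and3P[UA /asboolP Usat Ubig] Umin] := arg_minnP (fun U : {set J} => #|U|) satA.
have small (B : {set J}) : B \subset A -> (3 * #|B| <= 2 * #|A|)%N ->
    cost_le (3 * ln #|A|%:R + r) B.
  move=> BA cB; have [B0|B0] := posnP #|B|.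
    apply: cost_leW (const B BA _); first by rewrite B0 ln0 // mulr0 add0r lerDr mulr_ge0.
    by move=> j j'; move/eqP: B0; rewrite cards_eq0 => /eqP ->; rewrite inE.
  apply: cost_leW (IH B _ _); last 2 first.
  - by apply: leq_trans (_ : #|B| < #|A|)%N _; lia.
  - by move=> A' A'B; apply: const; apply: subset_trans BA.
  have := ln_two_thirds B0 cB; lra.
have ask (B : {set J}) : B \subset A ->
    (forall j j', j \in B -> j' \in A -> rho (ev j) = rho (ev j') -> j' \in B) ->
    cost_le (3 * ln #|A|%:R + r) B -> cost_le (3 * ln #|A|%:R + r) (A :\: B) ->
    cost_le (3 * ln #|A|%:R + (r + 1)) A.
  move=> BA Bsat cB cAB; rewrite addrA.
  pose h v := `[< exists2 j, j \in B & rho (ev j) = v >].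
  have hB j : j \in A -> h (rho (ev j)) = (j \in B).
    move=> jA; apply/asboolP/idP => [[j' j'B]|jB]; last by exists j.
    by move/Bsat; apply.
  apply: (cost_le_node (Qrho h)) => -[].
    rewrite (_ : [set j in A | _] = B) //; apply/setP => j; rewrite inE.
    case: (boolP (j \in A)) => [/hB->|jA] /=; first by rewrite eqb_id.
    by apply/esym; apply: contraNF jA; apply: (subsetP BA).
  rewrite (_ : [set j in A | _] = A :\: B) //; apply/setP => j; rewrite !inE.
  by case: (boolP (j \in A)) => [/hB->|jA] /=; rewrite ?andbF // andbT eqbF_neg.
have [cU|cU] := leqP (3 * #|U|) (2 * #|A|).
  apply: ask Usat _ _ => //; apply: small; rewrite ?subsetDl // cardsDS //.
  lia.
have A0 : (0 < #|A|)%N by apply/card_gt0P; exists j1.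
have /card_gt0P[j0 j0U] : (0 < #|U|)%N by lia.
(* Here U exceeds two thirds of A. Any class inside U will do: by minimality U without it is below a
   third of A, so W exceeds a third and its complement is below two thirds. *)
pose W := [set j in A | `[< rho (ev j) = rho (ev j0) >]].
have WU : W \subset U.
  apply/subsetP => j; rewrite inE => /andP[jA /asboolP h].
  exact: Usat j0U jA (esym h).
have WA : W \subset A by apply: subset_trans UA.
have cUW : (3 * #|U :\: W| < #|A|)%N.
  rewrite ltnNge; apply/negP => h.
  have : sat (U :\: W).
    apply/and3P; split => //; first by apply: subset_trans UA; apply: subsetDl.
    apply/asboolP => j j'; rewrite !inE => /andP[h1 jU] j'A jj'.
    rewrite (Usat j j') // andbT j'A /=; apply: contraNN h1 => /asboolP h2.
    by rewrite (subsetP UA) //=; apply/asboolP; rewrite jj'.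
  move/Umin; rewrite cardsDS // leqNgt => /negP; apply.
  rewrite ltn_subrL; apply/andP; split; apply/card_gt0P; exists j0 => //.
  by rewrite inE (subsetP UA) //=; apply/asboolP.
rewrite cardsDS // in cUW; have cWU := subset_leq_card WU.
apply: (ask W) => //.
- move=> j j'; rewrite !inE => /andP[_ /asboolP h] j'A jj'; rewrite j'A /=.
  by apply/asboolP; rewrite -jj'.
(* On W the response is known but the instances need not have decreased in number; this one query is
   charged to the [+ 1]. *)
- apply: cost_leW (const W WA _).
    rewrite lerD2r ler_pM2l // ler_ln ?posrE ?ltr0n //; last first.
      by apply/card_gt0P; exists j0; rewrite inE (subsetP UA) //=; apply/asboolP.
    by rewrite ler_nat subset_leq_card.
  by move=> j j'; rewrite !inE => /andP[_ /asboolP ->] /andP[_ /asboolP ->].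
- by apply: small; rewrite ?subsetDl // cardsDS //; have := subset_leq_card WA; lia.
Qed.

End Trees.

(** * Localization *)

Section Localization.
Variables (K : realType) (n d N : nat) (R eps : K) (G : chart K n d).
Variables (cls : set (instance K n d)) (ev : 'I_N -> instance K n d).
Hypotheses (R0 : 0 <= R) (hG : first_order_chart R cls G) (evcls : forall j, cls (ev j)).
Variables (T : finType) (pos : T -> 'rV[K]_(n + d)).
Implicit Types (cs : seq ('rV[K]_(n + d) * K)) (A : {set 'I_N}).

Definition cell cs : {set T} := [set t | all (fun c => dot c.1 (pos t) < c.2) cs].

Variables (tgt : 'I_N -> {set T}) (m u : nat) (alpha : K).
Hypotheses (tgt_sol : forall j t, t \in tgt j -> approx_solution eps (ev j) (pos t))
  (tgt_card : forall j, (m <= #|tgt j|)%N) (alpha0 : 0 <= alpha).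
Hypothesis center : forall cs, (size cs < u)%N -> (m <= #|cell cs|)%N ->
  exists z, [/\ box R z, Defs.integral (lsubmx z) &
    forall g, #|cell ((g, dot g z) :: cs)|%:R <= alpha * #|cell cs|%:R].
Hypothesis shrink : alpha ^+ u * #|T|%:R < m%:R.

Let Q := general_binary_oracle R G.
Let sol := @approx_solution K n d eps.

Lemma oracle_sep z : box R z -> forall h, Q (fun i => h (gsep G z i)).
Proof. by move=> zR h; exists z => //; apply: Or31; exists h. Qed.

Lemma oracle_val z : box R z -> forall h, Q (fun i => h (gval G z i)).
Proof. by move=> zR h; exists z => //; apply: Or32; exists h. Qed.

Lemma oracle_sub z : box R z -> forall h, Q (fun i => h (gsub G z i)).
Proof. by move=> zR h; exists z => //; apply: Or33; exists h. Qed.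

(* The incumbent is at least as good as every grid solution deleted so far. *)
Definition incumbent A cs (cand : option ('rV[K]_(n + d) * K)) : Prop :=
  forall j, j \in A ->
    (forall c, cand = Some c -> feasible (ev j) c.1 /\ obj (ev j) c.1 = c.2) /\
    (forall t, t \in tgt j -> t \notin cell cs ->
       exists2 c, cand = Some c & c.2 <= obj (ev j) (pos t)).

Lemma cost_empty (r : K) A : 0 <= r -> A = set0 -> cost_le Q sol ev r A.
Proof. by move=> r0 ->; exists 0%N => //; exists 0 => j; rewrite inE. Qed.

(** By counting, every target set has lost a point, and the incumbent is at least as good as that
    approximate solution. *)
Lemma solvable_small_cell A cs cand : (#|cell cs| < m)%N -> incumbent A cs cand ->
  solvable Q sol ev 0 A.
Proof.
move=> small inc.
have lost j : exists2 t, t \in tgt j & t \notin cell cs.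
  apply/exists_inP; rewrite -[X in is_true X]negbK negb_exists_in; apply/negP => /forall_inP h.
  suff : (#|tgt j| <= #|cell cs|)%N by move/(leq_trans (tgt_card j)); rewrite leqNgt small.
  by apply: subset_leq_card; apply/subsetP => t /h; rewrite negbK.
case: cand inc => [[z v]|] inc.
  exists z => j jA; have [h1 h2] := inc j jA; have [zf zv] := h1 _ erefl.
  split => // z' z'f; have [t tt tc] := lost j; have [_ [<-] vt] := h2 _ tt tc.
  by rewrite zv; apply: le_trans vt _; have [_] := tgt_sol tt; apply.
(* Without a candidate no instance can remain in A, so the output is arbitrary. *)
exists 0 => j jA; have [h1 h2] := inc j jA.
by have [t tt tc] := lost j; have [] := h2 _ tt tc.
Qed.

(** v counts the cuts still available. Each costs three queries, one for each of the three responses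
    at z, beyond those charged to 3 ln |A|. *)
Lemma localization_step v A cs cand : (size cs + v)%N = u ->
  #|cell cs|%:R * alpha ^+ v < m%:R -> incumbent A cs cand ->
  cost_le Q sol ev (3 * ln #|A|%:R + 3 * v%:R : K) A.
Proof.
have lnn (a : nat) : 0 <= ln a%:R :> K.
  by case: a => [|a]; [rewrite ln0|rewrite ln_ge0 // ler1n].
have box0 : box R (0 : 'rV[K]_(n + d)) by rewrite /box /= normr0.
have Q0 := oracle_sep box0 xpredT.
elim: v A cs cand => [|v IH] A cs cand hu hm inc.
  exists 0%N; first by rewrite mulr0 addr0 mulr_ge0.
  by apply: solvable_small_cell inc; rewrite -(ltr_nat K) -[ltLHS]mulr1.
have [small|big] := ltnP #|cell cs| m.
  exists 0%N; first by rewrite addr_ge0 ?mulr_ge0.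
  exact: solvable_small_cell inc.
have [|z [zR zI zg]] := center _ big; first by rewrite -hu addnS ltnS leq_addr.
have -> : 3 * ln #|A|%:R + 3 * v.+1%:R = 3 * ln #|A|%:R + (3 * v%:R + 1 + 1 + 1) :> K.
  by rewrite -natr1; ring.
have r0 : 0 <= 3 * v%:R :> K by rewrite mulr_ge0.
apply: (cost_le_learn Q0 (oracle_sep zR)) => [|A1 A1A c1]; first by rewrite !addr_ge0.
apply: (cost_le_learn Q0 (oracle_val zR)) => [|A2 A2A c2]; first by rewrite !addr_ge0.
apply: (cost_le_learn Q0 (oracle_sub zR)) => [|A3 A3A c3] //.
have [A30|/set0Pn[j0 j0A3]] := eqVneq A3 set0.
  by apply: cost_empty => //; rewrite addr_ge0 ?mulr_ge0.
have A32 := A3A.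
have A31 j : j \in A3 -> j \in A1 by move=> /(subsetP A32)/(subsetP A2A).
have {}A3A j : j \in A3 -> j \in A by move=> /A31/(subsetP A1A).
have same j : j \in A3 -> [/\ gsep G z (ev j) = gsep G z (ev j0),
    gval G z (ev j) = gval G z (ev j0) & gsub G z (ev j) = gsub G z (ev j0)].
  move=> jA; split; [apply: c1|apply: c2|exact: c3]; try exact: A31.
    exact: (subsetP A32).
  exact: (subsetP A32).
have shrunk g : #|cell ((g, dot g z) :: cs)|%:R * alpha ^+ v < m%:R.
  apply: le_lt_trans hm; rewrite exprS mulrA [X in _ <= X * _]mulrC.
  by rewrite ler_wpM2r ?exprn_ge0.
have hu' g : (size ((g, dot g z) :: cs) + v)%N = u by rewrite -hu addnS.
have cell_cons g t : t \in cell cs -> dot g (pos t) < dot g z -> t \in cell ((g, dot g z) :: cs).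
  by rewrite !inE /= => -> ->.
(* A unit separating vector is not 0, so the shared response makes z infeasible for all of A3. The
   cut then deletes no feasible grid point, and the incumbent stays valid. *)
have [zC|zC] := pselect (cset (ev j0) z); last first.
  apply: (IH A3 ((gsep G z (ev j0), dot (gsep G z (ev j0)) z) :: cs) cand) => //.
  move=> j jA; have [h1 h2] := inc j (A3A j jA); split => // t tt tc.
  apply: (h2 t tt); apply: contraNN tc => tc; apply: cell_cons => //.
  have [s1 _ _ _] := hG zR (evcls j); have [_ s2 _ _] := hG zR (evcls j0).
  have [_ s3 _ _] := hG zR (evcls j).
  have zCj : ~ cset (ev j) z.
    move=> /s1; have [-> _ _] := same j jA => s0.
    have [+ _] := s2 zC; rewrite s0 /l2norm dot0r sqrtr0 => /eqP.
    by rewrite eq_sym oner_eq0.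
  have [_] := s3 zCj; have [-> _ _] := same j jA; apply.
  by have [[]] := tgt_sol tt.
have zCj j : j \in A3 -> cset (ev j) z.
  move=> jA; apply: contrapT => nz; have [_ s3 _ _] := hG zR (evcls j).
  have [s1 _ _ _] := hG zR (evcls j0); have [+ _] := s3 nz.
  have [-> _ _] := same j jA; rewrite s1 // /l2norm dot0r sqrtr0 => /eqP.
  by rewrite eq_sym oner_eq0.
set g := gsub G z (ev j0); set w := gval G z (ev j0).
have valj j : j \in A3 -> obj (ev j) z = w.
  move=> jA; have [_ _ <- _] := hG zR (evcls j); by case: (same j jA).
have cutj j t : j \in A3 -> t \notin cell ((g, dot g z) :: cs) -> t \in cell cs ->
    w <= obj (ev j) (pos t).
  move=> jA tc tcs; have : dot g z <= dot g (pos t).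
    by rewrite leNgt; apply: contraNN tc; apply: cell_cons.
  have [_ _ _ /(_ (pos t))] := hG zR (evcls j); rewrite valj //.
  have [_ _ ->] := same j jA; rewrite -/g dotBr; lra.
(* A subgradient cut deletes only points with value at least w, so the better of z and the old
   candidate dominates everything deleted. *)
pose cand' := if cand is Some c then if w < c.2 then Some (z, w) else cand else Some (z, w).
apply: (IH A3 ((g, dot g z) :: cs) cand') => // j jA.
have [h1 h2] := inc j (A3A j jA); split.
  have hz : feasible (ev j) z /\ obj (ev j) z = w by rewrite valj //; split => //; split; [exact: zCj|].
  rewrite /cand'; case: (cand) h1 => [c|] h1 c' => [|[<-] //].
  by case: ifP => _; [case=> <-|apply: h1].
have [c' cE [cw cc]] : exists2 c', cand' = Some c' & c'.2 <= w /\
    (forall c, cand = Some c -> c'.2 <= c.2).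
  rewrite /cand'; case: (cand) => [c|]; last by exists (z, w) => //; split.
  have [cw|cw] := ltP w c.2.
    by exists (z, w) => //; split => // _ [<-]; apply: ltW.
  by exists c => //; split => // _ [<-].
move=> t tt tc; exists c' => //; have [tcs|tcs] := boolP (t \in cell cs).
  by apply: le_trans cw _; apply: cutj.
by have [c /cc h] := h2 t tt tcs; apply: le_trans.
Qed.

Lemma localization : exists (k : nat) D,
  [/\ query_strategy Q D, reports (range ev) sol D k & k%:R <= 3 * ln N%:R + 3 * u%:R :> K].
Proof.
have box0 : box R (0 : 'rV[K]_(n + d)) by rewrite /box /= normr0.
have Q0 := oracle_sep box0 xpredT.
have [||k kr /(solvable_strategy Q0)[D QD [out outP]]] :=
    @localization_step u [set: 'I_N] [::] None (erefl _).
- rewrite mulrC; apply: le_lt_trans shrink; rewrite ler_wpM2l ?exprn_ge0 // ler_nat.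
  exact: max_card.
- by move=> j _; split => // t _; rewrite inE.
exists k, D; split => //; last by move: kr; rewrite cardsT card_ord.
by exists out => _ [j _ <-]; apply: outP; rewrite inE.
Qed.

End Localization.

(** * Optimal solutions and grids of approximate solutions *)

Lemma norm_row_mx (K : realType) (n d : nat) (x : 'rV[K]_n) (y : 'rV[K]_d) (R : K) :
  0 <= R -> (`|row_mx x y| <= R) <-> (`|x| <= R) /\ (`|y| <= R).
Proof.
move=> R0; split=> [/(rV_normP _ R0) h|[/(rV_normP _ R0) hx /(rV_normP _ R0) hy]].
  split; apply/(rV_normP _ R0) => i.
    by have := h (lshift d i); rewrite row_mxEl.
  by have := h (rshift n i); rewrite row_mxEr.
by apply/(rV_normP _ R0) => i; rewrite mxE; case: split.
Qed.

Lemma integral_lattice (K : realType) (n : nat) (x : 'rV[K]_n) (R : K) : 0 <= R ->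
  Defs.integral x -> `|x| <= R -> exists p, x = lattice_point K (r := Num.truncn R) p.
Proof.
move=> R0 /mxOverP xint /(rV_normP _ R0) xR; set r := Num.truncn R.
pose Q (i : 'I_n) (k : 'I_(r.*2).+1) := x 0 i = k%:R - r%:R.
have [p pP] : exists p, forall i, Q i (p i).
  apply: fin_all_exists => i; have := xR i.
  have /intrP[k xk] := xint 0 i; rewrite xk => kR.
  have kr : (`|k| <= r)%N by rewrite truncn_ge_nat // natr_absz intr_norm.
  exists (inord `|(k + r%:Z)%R|%N); rewrite /Q inordK; last by lia.
  have -> : `|(k + r%:Z)%R|%N%:R = (k + r%:Z)%:~R :> K.
    by rewrite natr_absz ger0_norm //; lia.
  by rewrite intrD -pmulrn addrK xk.
by exists [ffun i => p i]; apply/rowP => i; rewrite mxE ffunE; apply: pP.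
Qed.

Lemma near_norm (K : realType) (d : nat) (y : 'rV[K]_d) (e : K) : 0 < e ->
  \forall y' \near y, `|y - y'| <= e.
Proof.
move=> e0; have := nbhsx_ballx y e e0; apply: filterS => y'.
by rewrite -ball_normE /ball_ /= => /ltW.
Qed.

Section Optimum.
Variables (K : realType) (n d : nat) (R rho M eps : K) (i : instance K n d).
Hypotheses (R0 : 0 < R) (rho0 : 0 < rho) (M0 : 0 < M) (eps0 : 0 < eps).
Hypotheses (icls : instance_class R rho M i) (ifeas : exists z, feasible i z).
Local Open Scope classical_set_scope.

Lemma cset_norm x y : cset i (row_mx x y) -> `|x| <= R /\ `|y| <= R.
Proof. by case: icls => _ [h _ _] /h /(norm_row_mx _ _ (ltW R0)). Qed.

Lemma obj_lipschitz x y y' : Defs.integral x -> `|x| <= R -> `|y| <= R -> `|y'| <= R ->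
  `|obj i (row_mx x y) - obj i (row_mx x y')| <= M * `|y - y'|.
Proof.
move=> xint xR yR y'R; case: icls => _ [_ _ /(_ x xint xR) h].
exact: (h (y, y')).
Qed.

(** Compactness is applied inside one integral fiber, where the Lipschitz condition gives
    continuity. *)
Lemma fiber_minimum x : Defs.integral x -> (exists y, cset i (row_mx x y)) ->
  exists2 y, cset i (row_mx x y) &
    forall y', cset i (row_mx x y') -> obj i (row_mx x y) <= obj i (row_mx x y').
Proof.
move=> xint [y0 y0C]; have [xR _] := cset_norm y0C.
pose S := [set y | cset i (row_mx x y)].
have Scl : closed S.
  case: icls => -[_ Ccl _] _ y yS; apply: Ccl => B /nbhs_ballP[e e0 eB].
  have [y' [y'S [_ yy']]] := yS _ (nbhsx_ballx y e e0).
  exists (row_mx x y'); split => //; apply: eB; split => // a b; rewrite !mxE.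
  by case: split => c; [apply: ballxx|apply: yy'].
have Sbd : bounded_set S.
  exists R; split => [|N RN y /cset_norm[_ yR]]; first exact: num_real.
  exact: le_trans yR (ltW RN).
have cf : {within S, continuous (fun y => obj i (row_mx x y))}.
  apply/subspace_continuousP => y yS; apply/cvgrPdist_le => e e0.
  have eM : 0 < e / M by rewrite divr_gt0.
  apply: (@filterS _ (nbhs y)) (near_norm y eM) => y' yy' y'S.
  apply: le_trans (obj_lipschitz xint xR _ _) _.
  - by case: (cset_norm yS).
  - by case: (cset_norm y'S).
  by rewrite mulrC -ler_pdivlMr.
have [|y yS ymin] := EVT_min_rV _ (bounded_closed_compact Sbd Scl) cf; first by exists y0.
by exists y; [apply/set_mem|move=> y' y'S; apply: ymin; apply/mem_set].
Qed.

(** The class provides a rho-ball only around a given optimal solution, so one has to exist.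
    Boundedness leaves finitely many lattice fibers, whose minima are compared. *)
Lemma optimal_exists : exists x y, optimal i (row_mx x y).
Proof.
pose F := {ffun 'I_n -> 'I_((Num.truncn R).*2).+1}.
pose P (p : F) := `[< exists y, cset i (row_mx (lattice_point K p) y) >].
pose Q (p : F) (y : 'rV[K]_d) := P p -> cset i (row_mx (lattice_point K p) y) /\
  forall y', cset i (row_mx (lattice_point K p) y') ->
    obj i (row_mx (lattice_point K p) y) <= obj i (row_mx (lattice_point K p) y').
have [y yP] : exists y : F -> 'rV[K]_d, forall p, Q p (y p).
  apply: fin_all_exists => p; have [Pp|nP] := boolP (P p); last first.
    by exists 0 => /(negP nP).
  have /asboolP/fiber_minimum[|y yC ymin] := Pp; first exact: lattice_point_integral.
  by exists y => _.
have lattice z : feasible i z -> exists p y', z = row_mx (lattice_point K p) y' /\ P p.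
  rewrite -[z]hsubmxK => -[zC]; rewrite row_mxKl => zI.
  have [zR _] := cset_norm zC.
  have [p pE] := integral_lattice (ltW R0) zI zR.
  by exists p, (rsubmx z); rewrite -pE; split=> //; apply/asboolP; exists (rsubmx z); rewrite -pE.
have [z0 /lattice[p0 [y0 [_ Pp0]]]] := ifeas.
pose v p := obj i (row_mx (lattice_point K p) (y p)).
case: (@arg_minP _ _ _ p0 P v Pp0) => p Pp pmin.
exists (lattice_point K p), (y p); have [yC ymin] := yP p Pp; split.
  by split=> //; rewrite row_mxKl; apply: lattice_point_integral.
move=> z zf; have [p' [y' [zE Pp']]] := lattice z zf; rewrite zE.
apply: le_trans (pmin _ Pp') _; have [_] := yP p' Pp'; apply.
by case: zf; rewrite zE.
Qed.

(* The rho-ball in the optimal fiber is contracted towards the optimum until the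
   Lipschitz bound makes all its points eps-approximate. *)
Lemma target_ball : exists x c, [/\ Defs.integral x, `|x| <= R &
  forall y, `|y - c| <= rho * Num.min 1 (eps / (2 * M * R)) ->
    `|y| <= R /\ approx_solution eps i (row_mx x y)].
Proof.
have [x [ys opt]] := optimal_exists; have [[xC xI] ymin] := opt.
have [xR ysR] := cset_norm xC; rewrite row_mxKl in xI.
have [[_ _ convC] [_ /(_ x ys opt)[yhat hy] _]] := icls.
set t := Num.min 1 _.
have D0 : 0 < 2 * M * R by rewrite !mulr_gt0.
have t0 : 0 < t by rewrite lt_min ltr01 divr_gt0.
have t1 : t <= 1 by rewrite ge_min lexx.
have tD : t * (2 * M * R) <= eps by rewrite -ler_pdivlMr // ge_min lexx orbT.
exists x, (ys + t *: (yhat - ys)); split => // y yc.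
(* y' is the preimage of y under the contraction, hence in the rho-ball. Moving from ys to y costs
   at most M t (2 R) <= eps, which is the origin of the factor eps / (2 M R). *)
pose y' := ys + t^-1 *: (y - ys).
have y'C : cset i (row_mx x y').
  apply: hy; rewrite (_ : y' - yhat = t^-1 *: (y - (ys + t *: (yhat - ys)))).
    by rewrite normrZ gtr0_norm ?invr_gt0 // ler_pdivrMl // mulrC.
  apply/rowP => j; rewrite !mxE; field; exact: lt0r_neq0.
have [_ y'R] := cset_norm y'C.
have yE : y = t *: y' + (1 - t) *: ys.
  by apply/rowP => j; rewrite !mxE; field; exact: lt0r_neq0.
have yC : cset i (row_mx x y).
  have /set_mem := convC _ _ (Itv01 (ltW t0) t1) (mem_set y'C) (mem_set xC).
  congr (cset i _).
  rewrite /conv /=. rewrite !scale_row_mx add_row_mx -yE -scalerDl.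
  by rewrite addrC subrK scale1r.
have [_ yR] := cset_norm yC; split => //; split.
  by split=> //; rewrite row_mxKl.
move=> z zf; apply: le_trans (lerD (ymin z zf) (lexx eps)).
have := obj_lipschitz xI xR yR ysR.
have -> : y - ys = t *: (y' - ys).
  by apply/rowP => j; rewrite !mxE; field; exact: lt0r_neq0.
rewrite normrZ gtr0_norm // ler_norml => /andP[_ h].
have h1 : `|y' - ys| <= 2 * R by apply: le_trans (ler_normB _ _) _; lra.
have h2 : M * t * `|y' - ys| <= M * t * (2 * R) by rewrite ler_wpM2l // mulr_ge0 // ltW.
lra.
Qed.

End Optimum.

Section Grid.
Variables (K : realType) (d L : nat) (R : K).

(* Centers of the cells of the subdivision of [-R, R]^d into L^d cubes. *)
Definition grid_point (q : {ffun 'I_d -> 'I_L}) : 'rV[K]_d :=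
  \row_j (2 * R / L%:R * ((q j)%:R + 1 / 2) - R).

Lemma grid_point_norm q : 0 <= R -> `|grid_point q| <= R.
Proof.
move=> R0; apply/rV_normP => // j; rewrite mxE.
have L0 : 0 < L%:R :> K by rewrite ltr0n; case: (L) (q j) => // -[].
have h : (q j)%:R + 1 <= L%:R :> K by rewrite natr1 ler_nat.
have c0 : 0 <= 2 * R / L%:R by rewrite divr_ge0 ?mulr_ge0 // ltW.
have h1 : 2 * R / L%:R * ((q j)%:R + 1 / 2) <= 2 * R / L%:R * L%:R.
  by rewrite ler_wpM2l //; lra.
rewrite divfK ?gt_eqF // in h1.
have h2 : 0 <= 2 * R / L%:R * ((q j)%:R + 1 / 2) by rewrite mulr_ge0 // addr_ge0 ?divr_ge0.
by rewrite ler_norml; apply/andP; split; lra.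
Qed.

(** A cube of side 2 s inside the box contains, along each axis, at least the floor of 2 s divided
    by the spacing 2 R / L many centers. *)
Lemma grid_ball_card (c : 'rV[K]_d) (s : K) : 0 < R -> 0 < s -> (0 < L)%N ->
  (forall y, `|y - c| <= s -> `|y| <= R) ->
  (Num.truncn (s * L%:R / R) ^ d <= #|[set q | (`|grid_point q - c| <= s)%R]|)%N.
Proof.
move=> R0 s0 L0 inR; set m := Num.truncn _.
have L0' : 0 < L%:R :> K by rewrite ltr0n.
have mle : m%:R <= s * L%:R / R.
  by rewrite truncn_le divr_ge0 ?mulr_ge0 // ltW.
have cR j : - R + s <= c 0 j <= R - s.
  have hp : `|c 0 j + s| <= R.
    have : `|c + const_mx s| <= R.
      apply: inR; rewrite addrAC subrr add0r; apply/(rV_normP _ (ltW s0)) => k.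
      by rewrite mxE gtr0_norm.
    by move/(rV_normP _ (ltW R0))/(_ j); rewrite !mxE.
  have hm : `|c 0 j - s| <= R.
    have : `|c - const_mx s| <= R.
      apply: inR; rewrite addrAC subrr add0r normrN; apply/(rV_normP _ (ltW s0)) => k.
      by rewrite mxE gtr0_norm.
    by move/(rV_normP _ (ltW R0))/(_ j); rewrite !mxE.
  by move: hp hm; rewrite !ler_norml => /andP[_ ?] /andP[? _]; apply/andP; split; lra.
pose w : K := L%:R / (2 * R).
have w0 : 0 < w by rewrite divr_gt0 // mulr_gt0.
(* The center of index floor(a j) lies above c 0 j - s by at most one spacing, so it starts a run of
   m centers inside the interval. *)
pose a j := (c 0 j - s + R) * w + 1 / 2.
have a0 j : 0 <= a j.
  have /andP[? _] := cR j.
  by apply: addr_ge0; [apply: mulr_ge0; [lra|exact: ltW]|exact: divr_ge0].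
pose k j := Num.truncn (a j).
have ka j : (k j)%:R <= a j by rewrite truncn_le.
have ak j : a j < (k j)%:R + 1 by have /andP[_] := truncn_itv (a0 j); rewrite -natr1.
have mw : m%:R <= 2 * s * w.
  apply: le_trans mle _; rewrite le_eqVlt; apply/orP; left; apply/eqP.
  rewrite /w; field; exact: lt0r_neq0.
have hi j (e : 'I_m) : (k j + e)%:R + 1 / 2 <= (c 0 j + s + R) * w.
  have em : e%:R + 1 <= m%:R :> K by rewrite natr1 ler_nat.
  rewrite natrD; have := ka j; rewrite /a; lra.
have lo j (e : 'I_m) : (c 0 j - s + R) * w <= (k j + e)%:R + 1 / 2.
  have e0 : 0 <= e%:R :> K by [].
  rewrite natrD; have := ak j; rewrite /a; lra.
have lt j (e : 'I_m) : (k j + e < L)%N.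
  rewrite -(ltr_nat K); have h1 := hi j e.
  have : (c 0 j + s + R) * w <= 2 * R * w.
    by rewrite ler_wpM2r ?(ltW w0) //; have /andP[_ ?] := cR j; lra.
  have -> : 2 * R * w = L%:R by rewrite /w; field; exact: lt0r_neq0.
  lra.
pose f (e : {ffun 'I_d -> 'I_m}) : {ffun 'I_d -> 'I_L} := [ffun j => Ordinal (lt j (e j))].
have finj : injective f.
  move=> e e' /ffunP ee'; apply/ffunP => j; have := ee' j; rewrite !ffunE => /(congr1 val) /= h.
  by apply: val_inj; apply/eqP; rewrite -(eqn_add2l (k j)) h.
have -> : (m ^ d = #|[set f e | e in {: {ffun 'I_d -> 'I_m}}]|)%N.
  by rewrite card_imset // card_ffun !card_ord.
apply: subset_leq_card; apply/subsetP => _ /imsetP[e _ ->]; rewrite inE.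
apply/(rV_normP _ (ltW s0)) => j; rewrite !mxE ffunE /=.
have wE : 2 * R / L%:R = w^-1 by rewrite /w invf_div.
rewrite wE ler_norml.
have h1 : w^-1 * ((k j + e j)%:R + 1 / 2) <= c 0 j + s + R.
  by rewrite mulrC ler_pdivrMr.
have h2 : c 0 j - s + R <= w^-1 * ((k j + e j)%:R + 1 / 2).
  by rewrite mulrC ler_pdivlMr.
by apply/andP; split; lra.
Qed.

End Grid.

Lemma finite_enum (V : Type) (I : set V) (N : nat) : (I #= `I_N)%card ->
  exists ev : 'I_N -> V, (forall j, I (ev j)) /\ (I `<=` range ev)%classic.
Proof.
move=> /card_set_bijP[f [fI finj fsurj]].
pose Q (j : 'I_N) i := I i /\ f i = j.
have [ev evP] : exists ev : 'I_N -> V, forall j, Q j (ev j).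
  by apply: fin_all_exists => j; have [i Ii fi] := fsurj j (ltn_ord j); exists i.
exists ev; split => [j|i Ii]; first by case: (evP j).
have [Ij fj] := evP (Ordinal (fI i Ii)).
by exists (Ordinal (fI i Ii)) => //; apply: finj; rewrite ?mem_set // fj.
Qed.

(** * Choice of parameters and the two query bounds *)

Section Numerics.
Variable K : realType.

Lemma ln2_ge : 1 / 2 <= ln 2 :> K.
Proof.
rewrite -ler_expR lnK ?posrE //.
have h : 1 / 2 <= expR (- (1 / 2)) :> K by apply: le_trans (expR_ge1Dx _); lra.
have p : 0 < expR (1 / 2) :> K by apply: expR_gt0.
rewrite expRN in h.
have : 1 / 2 * expR (1 / 2) <= 1 :> K by rewrite -ler_pdivlMr // [leRHS]mul1r.
lra.
Qed.

Lemma pow4_bounds (x : K) : 2 <= x -> 4 * x <= x ^+ 4 /\ 4 * x ^+ 2 <= x ^+ 4.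
Proof.
move=> x2; have x0 : 0 <= x by apply: le_trans x2.
have h2 : 2 * 2 <= x * x by apply: ler_pM.
have h3 : 4 * (x * x) <= x * x * (x * x) by rewrite ler_wpM2r ?mulr_ge0 //; lra.
have h4 : 1 * x <= x * x by rewrite ler_wpM2r //; lra.
by rewrite !exprS expr0 !mulrA mulr1; split; lra.
Qed.

Lemma shrink_power (H P : K) (u : nat) : 1 <= H -> 0 < P -> H * ln P < u%:R ->
  (1 - 1 / H) ^+ u * P < 1.
Proof.
move=> H1 P0 hu; have H0 : 0 < H by apply: lt_le_trans H1.
have a0 : 0 <= 1 - 1 / H by rewrite subr_ge0 ler_pdivrMr // mul1r.
have ale : (1 - 1 / H) ^+ u <= expR (- (u%:R / H)).
  rewrite (_ : - (u%:R / H) = u%:R * - (1 / H)); last by rewrite mulrN mulrA mulr1.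
  by rewrite expRM_natl lerXn2r ?nnegrE ?expR_ge0 // expR_ge1Dx.
apply: le_lt_trans (_ : expR (- (u%:R / H)) * P < 1); first by rewrite ler_pM2r.
rewrite -[X in _ * X]lnK ?posrE // -expRD -[ltRHS]expR0 ltr_expR addrC subr_lt0.
by rewrite ltr_pdivlMr // mulrC.
Qed.

Variables (R rho M eps Lam : K).
Hypotheses (R0 : 0 < R) (rho0 : 0 < rho) (eps0 : 0 < eps) (epsM : eps <= M).
Hypotheses (Lam2 : 2 <= Lam) (hLam : M * R / (Num.min rho 1 * eps) <= Lam).

(** R / s measures how fine a grid must be to meet a target cube. If s = rho it is at most Lam;
    otherwise it is 2 M R^2 / (rho eps) <= 2 R Lam, and R <= Lam follows from eps <= M. *)
Lemma radius_bounds (s := rho * Num.min 1 (eps / (2 * M * R))) :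
  [/\ 0 < s, R <= Lam & R <= 2 * Lam ^+ 2 * s].
Proof.
have M0 : 0 < M by apply: lt_le_trans epsM.
have hL := hLam; set mu := Num.min rho 1 in hL.
have mu0 : 0 < mu by rewrite lt_min rho0 ltr01.
have mu1 : mu <= 1 by rewrite ge_min lexx orbT.
have mur : mu <= rho by rewrite ge_min lexx.
have key : M * R <= Lam * (mu * eps) by rewrite -ler_pdivrMr // mulr_gt0.
have L2 := Lam2; have Lam0 : 0 < Lam by apply: lt_le_trans L2.
have h1 : R <= Lam * mu.
  rewrite -(ler_pM2l M0); apply: le_trans key _.
  by rewrite mulrA mulrC ler_wpM2r // mulr_ge0 // ltW.
have RLam : R <= Lam by apply: le_trans h1 _; rewrite -[leRHS]mulr1 ler_pM2l.
have D0 : 0 < 2 * M * R by rewrite !mulr_gt0.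
split => //; first by rewrite mulr_gt0 // lt_min ltr01 divr_gt0.
rewrite /s; case: (leP 1 (eps / (2 * M * R))) => _.
  rewrite mulr1; apply: le_trans (_ : Lam * rho <= _).
    by apply: le_trans h1 _; rewrite ler_pM2l.
  rewrite ler_wpM2r ?(ltW rho0) // expr2 mulrA -[leLHS]mul1r ler_wpM2r ?(ltW Lam0) //; lra.
rewrite !mulrA ler_pdivlMr //.
have h2 : M * R <= Lam * (rho * eps).
  by apply: le_trans key _; rewrite ler_pM2l // ler_wpM2r // ltW.
have h3 : R * (M * R) <= Lam * (Lam * (rho * eps)).
  by apply: ler_pM => //; rewrite ?mulr_ge0 ?(ltW R0) ?(ltW M0).
lra.
Qed.

End Numerics.

Section Target.
Variables (K : realType) (n d : nat) (R rho M eps : K) (i : instance K n d).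
Hypotheses (R0 : 0 < R) (rho0 : 0 < rho) (M0 : 0 < M) (eps0 : 0 < eps).
Hypotheses (icls : instance_class R rho M i) (ifeas : exists z, feasible i z).

Lemma approx_grid (L : nat) (s := rho * Num.min 1 (eps / (2 * M * R))) : (0 < L)%N ->
  exists x, [/\ Defs.integral x, `|x| <= R &
   (Num.truncn (s * L%:R / R) ^ d <=
     #|[set q : {ffun 'I_d -> 'I_L} |
        `[< approx_solution eps i (row_mx x (grid_point R q)) >]]|)%N].
Proof.
move=> L0; have [x [c [xI xR ball]]] := target_ball R0 M0 eps0 icls ifeas.
have s0 : 0 < s by rewrite mulr_gt0 // lt_min ltr01 divr_gt0 // !mulr_gt0.
exists x; split => //; apply: leq_trans (grid_ball_card R0 s0 L0 (c := c) _) _.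
  by move=> y /ball[].
apply: subset_leq_card; apply/subsetP => q; rewrite !inE => /ball[_ h].
exact/asboolP.
Qed.

End Target.

Section Strategies.
Variable K : realType.

Lemma mixed_strategy (n d : nat) (R rho M eps : K) (I : set (instance K n d)) (N : nat)
    (G : chart K n d) (Lam : K) :
  (0 < d)%N -> 0 < R -> 0 < rho -> 0 < eps -> eps <= M -> 2 <= Lam ->
  M * R / (Num.min rho 1 * eps) <= Lam ->
  (I `<=` instance_class R rho M)%classic -> (forall i, I i -> exists z, feasible i z) ->
  (I #= `I_N)%card -> first_order_chart R (instance_class R rho M) G ->
  exists (k u : nat) D, [/\ query_strategy (general_binary_oracle R G) D,
    reports I (@approx_solution K n d eps) D k, k%:R <= 3 * ln N%:R + 3 * u%:R :> K &
    u%:R <= 2 ^+ n * d.+1%:R * ((n + d)%:R * (4 * ln Lam)) + 1].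
Proof.
move=> d0 R0 rho0 eps0 epsM Lam2 hLam Icls Ifeas IN hG.
have M0 : 0 < M by apply: lt_le_trans epsM.
have [ev [evI Iev]] := finite_enum IN.
have := radius_bounds R0 rho0 eps0 epsM Lam2 hLam.
set s := rho * _ => -[s0 RLam Rs].
(* The spacing 2 R / L is at most the side 2 s of a target cube, so every target contains a grid
   point. *)
pose L := (Num.truncn (R / s)).+1; pose r := Num.truncn R.
pose T := ({ffun 'I_n -> 'I_(r.*2).+1} * {ffun 'I_d -> 'I_L})%type.
pose pos (t : T) : 'rV[K]_(n + d) := row_mx (lattice_point K t.1) (grid_point R t.2).
pose tgt (j : 'I_N) := [set t | `[< approx_solution eps (ev j) (pos t) >]].
pose H := (2 ^ n * d.+1)%N.
have H1 : 1 <= H%:R :> K by rewrite ler1n muln_gt0 expn_gt0.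
have H0 : 0 < H%:R :> K by apply: lt_le_trans H1.
(* Both 2 r + 1 <= 2 Lam + 1 and L <= 2 Lam^2 + 1 are at most Lam^4. *)
pose P : K := (Lam ^+ 4) ^+ (n + d).
have Lam0 : 0 < Lam by lra.
have Lam1 : 1 <= Lam by lra.
have P0 : 0 < P by rewrite !exprn_gt0.
have lnP : ln P = (n + d)%:R * (4 * ln Lam).
  by rewrite !lnXn ?exprn_gt0 // -[in LHS]mulr_natl -[X in _ * X]mulr_natl.
pose u := (Num.truncn (H%:R * ln P)).+1.
have hu : H%:R * ln P < u%:R by apply: truncnS_gt.
have rR : r%:R <= R by rewrite truncn_le ltW.
have RLs : R <= s * L%:R.
  by rewrite mulrC -ler_pdivrMr // ltW // truncnS_gt.
have cardT : #|{: T}|%:R <= P.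
  rewrite card_prod !card_ffun !card_ord natrM !natrX /P exprD.
  have L4 := pow4_bounds Lam2.
  apply: ler_pM; rewrite ?exprn_ge0 ?ler0n // lerXn2r ?nnegrE ?exprn_ge0 ?(ltW Lam0) //.
    rewrite -addn1 -muln2 natrD natrM; case: L4; lra.
  rewrite /L -natr1.
  have : (Num.truncn (R / s))%:R <= 2 * Lam ^+ 2.
    apply: le_trans (_ : R / s <= _); first by rewrite truncn_le divr_ge0 ?ltW.
    by rewrite ler_pdivrMr.
  have : 1 <= Lam ^+ 2 by rewrite exprn_ege1.
  case: L4; lra.
have [|j t|j||||k [D [DQ Drep kle]]] := @localization K n d N R eps G _ ev (ltW R0) hG _ T pos tgt 1 u
    (1 - 1 / H%:R).
- by move=> j; apply: Icls.
- by rewrite inE => /asboolP.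
- have [x [xI xR]] := approx_grid R0 rho0 M0 eps0 (Icls _ (evI j)) (Ifeas _ (evI j)) (ltn0Sn _ : 0 < L)%N.
  have [p pE] := integral_lattice (ltW R0) xI xR.
  have m1 : (0 < Num.truncn (s * L%:R / R) ^ d)%N.
    have sLR : 1 <= s * L%:R / R by rewrite ler_pdivlMr // mul1r.
    by rewrite expn_gt0 truncn_ge_nat ?sLR // (le_trans _ sLR).
  move=> /(leq_trans m1)/card_gt0P[q]; rewrite inE pE => /asboolP h.
  by apply/card_gt0P; exists (p, q); rewrite inE; apply/asboolP.
- by rewrite subr_ge0 ler_pdivrMr // mul1r.
- move=> cs _ _; have [||z [zR zI zg]] := @mixed_center K n d r T R pos fst rR _ _ (cell pos cs).
  + by move=> t; rewrite row_mxKl.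
  + move=> t; apply/(norm_row_mx _ _ (ltW R0)); split; last exact: grid_point_norm (ltW R0).
    by apply: le_trans rR; apply: lattice_point_norm.
  exists z; split => // g.
  have := zg g; set cut := [set t in _ | _] => h.
  have kept : (#|cell pos ((g, dot g z) :: cs)| + #|cut| = #|cell pos cs|)%N.
    rewrite -(cardsID cut (cell pos cs)) addnC; congr (_ + _)%N.
      by apply: eq_card => t; rewrite !inE /=; case: (all _ _).
    by apply: eq_card => t; rewrite !inE /=; case: (all _ _); rewrite ?andbT ?andbF //= -ltNge.
  rewrite -kept natrD; move: h; rewrite -(ler_nat K) natrM -/H -kept natrD.
  set a := #|_|%:R; set b := #|_|%:R => h.
  have h1 : (a + b) / H%:R <= b by rewrite ler_pdivrMr // mulrC.
  by rewrite mulrBl mul1r mul1r [_^-1 * _]mulrC; lra.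
- apply: le_lt_trans (shrink_power H1 P0 hu); rewrite ler_wpM2l // exprn_ge0 //.
  by rewrite subr_ge0 ler_pdivrMr // mul1r.
exists k, u, D; split => //.
  by case: Drep => out outP; exists out => i /Iev; apply: outP.
rewrite /u -natr1 lerD2r; apply: le_trans (_ : H%:R * ln P <= _).
  by rewrite truncn_le mulr_ge0 // lnP !mulr_ge0 // ln_ge0.
by rewrite lnP /H natrM natrX.
Qed.

End Strategies.

Section Continuous.
Variables (K : realType) (d L : nat) (R : K).
Hypothesis R0 : 0 < R.
Local Notation T := {ffun 'I_d -> 'I_L}.

Definition continuous_grid_point (q : T) : 'rV[K]_(0 + d) := row_mx 0 (grid_point R q).

Let w (g : 'rV[K]_(0 + d)) (j : 'I_d) : K := g 0 (rshift 0 j) * (2 * R / L%:R).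
Let kappa (g : 'rV[K]_(0 + d)) : K :=
  \sum_j g 0 (rshift 0 j) * (2 * R / L%:R * (1 / 2) - R).

Lemma dot_continuous_grid_point g q : dot g (continuous_grid_point q) = lin (w g) q + kappa g.
Proof.
rewrite /dot big_split_ord /= big_ord0 add0r /lin /kappa -big_split /=.
apply: eq_bigr => j _; rewrite row_mxEr mxE /w; ring.
Qed.

Lemma continuous_center (gamma : K) (J u : nat) (cs : seq ('rV[K]_(0 + d) * K)) :
  0 < gamma -> 5 * d%:R < gamma * 2 ^+ J -> 5 <= gamma * L%:R ->
  200 * (u.+1%:R * (d%:R + 1)) * 4 ^+ J <= gamma * L%:R ->
  (0 < d)%N -> (size cs < u)%N -> gamma * L%:R ^+ d <= #|cell continuous_grid_point cs|%:R ->
  exists z, [/\ box R z, Defs.integral (lsubmx z) &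
    forall g, #|cell continuous_grid_point ((g, dot g z) :: cs)|%:R <=
      (1 - 1 / 10) * #|cell continuous_grid_point cs|%:R :> K].
Proof.
move=> gam0 hJ hL hu d0 su; set X := cell continuous_grid_point cs => Xbig.
pose cs' := [seq (w c.1, c.2 - kappa c.1) | c <- cs].
have XE : X = cube_cell L cs'.
  apply/setP => q; rewrite !inE /cs' all_map; apply: eq_all => c /=.
  by rewrite dot_continuous_grid_point ltrBrDr.
have L0 : 0 < L%:R :> K by rewrite -(pmulr_rgt0 _ gam0); apply: lt_le_trans hL.
have W0 : 0 < #|X|%:R :> K by apply: lt_le_trans Xbig; rewrite mulr_gt0 // exprn_gt0.
(* At the centroid the values dot g (continuous_grid_point q) - dot g z sum to zero over X, the
   balance condition of [cube_center]. *)
pose z := #|X|%:R^-1 *: \sum_(q in X) continuous_grid_point q.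
have dotz g : dot g z * #|X|%:R = \sum_(q in X) dot g (continuous_grid_point q).
  by rewrite /z dotZr mulrAC mulVf ?gt_eqF // mul1r dot_sumr.
exists z; split.
- rewrite /box /= /z normrZ gtr0_norm ?invr_gt0 // ler_pdivrMl //.
  apply: le_trans (ler_norm_sum _ _ _) _; rewrite mulr_natl -sumr_const.
  apply: ler_sum => q _; apply/(norm_row_mx _ _ (ltW R0)); split; first by rewrite normr0 ltW.
  exact: grid_point_norm (ltW R0).
- by apply/mxOverP => a [].
move=> g; pose mu := dot g z - kappa g.
have big : #|X|%:R <= 10 * #|[set q in X | mu <= lin (w g) q]|%:R :> K.
  rewrite XE; apply: (cube_center (cs := cs') gam0 hJ hL hu d0); rewrite -?XE //.
    by rewrite size_map ltnW.
  rewrite (eq_bigr (fun q => dot g (continuous_grid_point q) - dot g z)); last first.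
    by move=> q _; rewrite dot_continuous_grid_point /mu; ring.
  by rewrite sumrB -dotz sumr_const -[X in _ - X]mulr_natr subrr.
set cut := [set q in X | _] in big.
have kept : (#|cell continuous_grid_point ((g, dot g z) :: cs)| + #|cut| = #|X|)%N.
  rewrite -(cardsID cut X) addnC; congr (_ + _)%N.
    by apply: eq_card => t; rewrite !inE /=; case: (all _ _).
  apply: eq_card => t; rewrite !inE /= /mu lerBlDr -dot_continuous_grid_point.
  by case: (all _ _); rewrite ?andbT ?andbF //= -ltNge.
have : #|cell continuous_grid_point ((g, dot g z) :: cs)|%:R + #|cut|%:R = #|X|%:R :> K.
  by rewrite -natrD kept.
lra.
Qed.

End Continuous.

Lemma continuous_strategy (K : realType) (d : nat) (R rho M eps : K)
    (I : set (instance K 0 d)) (N : nat) (G : chart K 0 d) (Lam : K) :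
  (0 < d)%N -> 0 < R -> 0 < rho -> 0 < eps -> eps <= M -> 2 <= Lam ->
  M * R / (Num.min rho 1 * eps) <= Lam ->
  (I `<=` instance_class R rho M)%classic -> (forall i, I i -> exists z, feasible i z) ->
  (I #= `I_N)%card -> first_order_chart R (instance_class R rho M) G ->
  exists (k u : nat) D, [/\ query_strategy (general_binary_oracle R G) D,
    reports I (@approx_solution K 0 d eps) D k, k%:R <= 3 * ln N%:R + 3 * u%:R :> K &
    u%:R <= 10 * (d%:R * (4 * ln Lam)) + 1].
Proof.
move=> d0 R0 rho0 eps0 epsM Lam2 hLam Icls Ifeas IN hG.
have M0 : 0 < M by apply: lt_le_trans epsM.
have [ev [evI Iev]] := finite_enum IN.
have := radius_bounds R0 rho0 eps0 epsM Lam2 hLam.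
set s := rho * _ => -[s0 RLam Rs].
have Lam0 : 0 < Lam by lra.
have Lam1 : 1 <= Lam by lra.
pose P : K := (Lam ^+ 4) ^+ d.
have P0 : 0 < P by rewrite !exprn_gt0.
have lnP : ln P = d%:R * (4 * ln Lam).
  by rewrite !lnXn ?exprn_gt0 // -[in LHS]mulr_natl -[X in _ * X]mulr_natl.
pose u := (Num.truncn (10 * ln P)).+1.
have hu : 10 * ln P < u%:R by apply: truncnS_gt.
(* A target cube has relative side s / R. Half of it leaves room for the floor, so each target keeps
   at least (gam L)^d of the L^d grid points. *)
pose gam := s / (2 * R); have gam0 : 0 < gam by rewrite divr_gt0 // mulr_gt0.
have Lamgam : 1 <= Lam ^+ 4 * gam.
  have h : 4 * Lam ^+ 2 * s <= Lam ^+ 4 * s.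
    by rewrite ler_wpM2r ?(ltW s0) //; case: (pow4_bounds Lam2).
  by rewrite /gam mulrA ler_pdivlMr ?mulr_gt0 //; lra.
pose gamma := gam ^+ d; have gamma0 : 0 < gamma by rewrite exprn_gt0.
pose J := (Num.truncn (5 * d%:R / gamma)).+1.
have hJ : 5 * d%:R < gamma * 2 ^+ J.
  rewrite [ltRHS]mulrC -ltr_pdivrMr //; apply: lt_le_trans (truncnS_gt _) _.
  by rewrite -natrX ler_nat ltnW // ltn_expl.
pose c : K := 200 * (u.+1%:R * (d%:R + 1)) * 4 ^+ J.
have c0 : 0 <= c.
  by apply: mulr_ge0; rewrite ?exprn_ge0 // mulr_ge0 // ?ler0n // mulr_ge0 // addr_ge0.
(* L comes last, as c depends on u and J. The summand 5 + c meets the fineness conditions of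
   [continuous_center]; gam^-1 makes gam L >= 1, so that the floor in m loses at most half. *)
pose L := (Num.truncn ((5 + c) / gamma + gam^-1)).+1.
have hL : (5 + c) / gamma + gam^-1 < L%:R by apply: truncnS_gt.
have cg : 0 <= (5 + c) / gamma by rewrite divr_ge0 ?addr_ge0 // ltW.
have hL1 : 5 + c <= gamma * L%:R.
  rewrite [leRHS]mulrC -ler_pdivrMr //; have : 0 < gam^-1 by rewrite invr_gt0.
  lra.
have hL2 : 1 <= gam * L%:R.
  by rewrite [leRHS]mulrC -ler_pdivrMr // mul1r; lra.
have L0 : 0 < L%:R :> K by [].
pose m := Num.truncn (s * L%:R / R).
have mgam : gam * L%:R <= m%:R.
  have : s * L%:R / R < m%:R + 1 by rewrite natr1 truncnS_gt.
  rewrite (_ : s * L%:R / R = 2 * (gam * L%:R)); first lra.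
  by rewrite /gam; field; exact: lt0r_neq0.
have evC j : instance_class R rho M (ev j) by apply: Icls.
pose tgt (j : 'I_N) := [set q : {ffun 'I_d -> 'I_L} |
  `[< approx_solution eps (ev j) (continuous_grid_point R q) >]].
have loc := @localization K 0 d N R eps G _ ev (ltW R0) hG evC _
  (continuous_grid_point R) tgt (m ^ d) u (1 - 1 / 10).
have [j t|j||||k [D [DQ Drep kle]]] := loc.
- by rewrite inE => /asboolP.
- have [x [xI xR]] := approx_grid R0 rho0 M0 eps0 (Icls _ (evI j)) (Ifeas _ (evI j)) (ltn0Sn _ : 0 < L)%N.
  have -> : x = 0 by apply/rowP => -[].
  by [].
- by rewrite subr_ge0 ler_pdivrMr // mul1r ler1n.
- move=> cs su mX.
  have mX' : gamma * L%:R ^+ d <= #|cell (@continuous_grid_point K d L R) cs|%:R.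
    apply: (@le_trans _ _ (m%:R ^+ d : K)); last by rewrite -natrX ler_nat.
    by rewrite /gamma -exprMn lerXn2r ?nnegrE // mulr_ge0 // ltW.
  have hL5 : 5 <= gamma * L%:R by apply: le_trans hL1; rewrite lerDl.
  have hLc : c <= gamma * L%:R by apply: le_trans hL1; rewrite lerDr.
  exact: (continuous_center R0 gamma0 hJ hL5 hLc d0 su mX').
- have m0 : 0 < m%:R :> K by apply: lt_le_trans mgam; rewrite mulr_gt0.
  rewrite card_ffun !card_ord !natrX.
  (* L <= Lam^4 gam L <= Lam^4 m: the grid exceeds a target by a factor of at most P, whatever L
     is. *)
  apply: le_lt_trans (_ : (1 - 1 / 10) ^+ u * (P * m%:R ^+ d) < _).
    rewrite ler_wpM2l // ?exprn_ge0 //; first by rewrite subr_ge0 ler_pdivrMr // mul1r ler1n.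
    rewrite /P -exprMn lerXn2r ?nnegrE ?mulr_ge0 ?exprn_ge0 ?(ltW Lam0) //.
    apply: le_trans (_ : Lam ^+ 4 * (gam * L%:R) <= _).
      by rewrite mulrA -[leLHS]mul1r ler_wpM2r.
    by rewrite ler_wpM2l // exprn_ge0 // ltW.
  rewrite mulrA -[ltRHS]mul1r ltr_pM2r ?exprn_gt0 //.
  by apply: shrink_power; rewrite ?ler1n.
exists k, u, D; split => //.
  by case: Drep => out outP; exists out => i /Iev; apply: outP.
rewrite /u -natr1 lerD2r; apply: le_trans (_ : 10 * ln P <= _).
  by rewrite truncn_le mulr_ge0 // lnP !mulr_ge0 // ln_ge0.
by rewrite lnP.
Qed.
Local Open Scope classical_set_scope.

Theorem corollary13 (K : realType) :
  exists2 c : K, 0 < c &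
    (forall (n d : nat) (R rho M eps : K)
       (I : set (instance K n d)) (N : nat) (G : chart K n d),
       (0 < d)%N -> 0 < R -> 0 < rho -> 0 < eps ->
       eps <= M ->
       2 <= d%:R * M * R / (Num.min rho 1 * eps) ->
       I `<=` instance_class R rho M ->
       (forall i, I i -> exists z, feasible i z) ->
       (I #= `I_N)%card ->
       first_order_chart R (instance_class R rho M) G ->
       exists (k : nat) (D : history (instance K n d) bool ->
                             query (instance K n d) bool),
         [/\ query_strategy (general_binary_oracle R G) D,
             reports I (@approx_solution K n d eps) D k
           & k%:R <= c * (ln N%:R + 2 ^+ n * d%:R * (n + d)%:R *
               ln (d%:R * M * R / (Num.min rho 1 * eps)))])
    /\
    (forall (d : nat) (R rho M eps : K)
       (I : set (instance K 0 d)) (N : nat) (G : chart K 0 d),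
       (0 < d)%N -> 0 < R -> 0 < rho -> 0 < eps ->
       eps <= M ->
       2 <= M * R / (Num.min rho 1 * eps) ->
       I `<=` instance_class R rho M ->
       (forall i, I i -> exists z, feasible i z) ->
       (I #= `I_N)%card ->
       first_order_chart R (instance_class R rho M) G ->
       exists (k : nat) (D : history (instance K 0 d) bool ->
                             query (instance K 0 d) bool),
         [/\ query_strategy (general_binary_oracle R G) D,
             reports I (@approx_solution K 0 d eps) D k
           & k%:R <= c * (ln N%:R + d%:R *
               ln (M * R / (Num.min rho 1 * eps)))]).
Proof.
have lnn (N : nat) : 0 <= ln N%:R :> K.
  by case: N => [|N]; [rewrite ln0|rewrite ln_ge0 // ler1n].
have lnLam (Lam : K) : 2 <= Lam -> 1 / 2 <= ln Lam.
  by move=> h; apply: le_trans (ln2_ge K) _; rewrite ler_ln ?posrE //; lra.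
(* As d + 1 <= 2 d, the term 3 u is at most 24 times the main term plus 3 for mixed instances, and
   120 times it plus 3 for n = 0. The constant 3 is absorbed by ln Lam >= 1/2. *)
exists 200; first by rewrite ltr0n.
split.
  move=> n d R rho M eps I N G d0 R0 rho0 eps0 epsM Lam2 Icls Ifeas IN hG.
  set Lam := d%:R * M * R / _ in Lam2 *.
  have d1 : 1 <= d%:R :> K by rewrite ler1n.
  have hLam : M * R / (Num.min rho 1 * eps) <= Lam.
    have M0 : 0 < M by apply: lt_le_trans epsM.
    have q0 : 0 < Num.min rho 1 * eps by rewrite mulr_gt0 // lt_min rho0 ltr01.
    rewrite /Lam -!(mulrA d%:R) -[leLHS]mul1r ler_wpM2r //.
    by rewrite ltW // divr_gt0 // mulr_gt0.
  have [k [u [D [DQ Drep kle ule]]]] :=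
    mixed_strategy d0 R0 rho0 eps0 epsM Lam2 hLam Icls Ifeas IN hG.
  exists k, D; split => //; apply: le_trans kle _.
  have := lnLam _ Lam2; have := lnn N; move: ule.
  set p := 2 ^+ n; set b := (n + d)%:R; set l := ln Lam; set e := ln N%:R => ule e0 l0.
  have p1 : 1 <= p by rewrite exprn_ege1 // ler1n.
  have b1 : 1 <= b by rewrite ler1n addn_gt0 d0 orbT.
  have pd1 : 1 <= p * d%:R by rewrite -[leLHS]mulr1 ler_pM.
  have pdb1 : 1 <= p * d%:R * b by rewrite -[leLHS]mulr1 ler_pM.
  have h1 : 1 * l <= p * d%:R * b * l by rewrite ler_wpM2r //; lra.
  have h2 : p * d.+1%:R * (b * (4 * l)) <= p * (2 * d%:R) * (b * (4 * l)).
    rewrite ler_wpM2r //; first by rewrite !mulr_ge0 //; lra.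
    by rewrite ler_wpM2l // ?(le_trans _ p1) // -natr1; lra.
  lra.
move=> d R rho M eps I N G d0 R0 rho0 eps0 epsM Lam2 Icls Ifeas IN hG.
have [k [u [D [DQ Drep kle ule]]]] :=
  continuous_strategy d0 R0 rho0 eps0 epsM Lam2 (lexx _) Icls Ifeas IN hG.
exists k, D; split => //; apply: le_trans kle _.
have := lnLam _ Lam2; have := lnn N; move: ule.
set l := ln (M * R / _); set e := ln N%:R => ule e0 l0.
have d1 : 1 <= d%:R :> K by rewrite ler1n.
have h1 : 1 * l <= d%:R * l by rewrite ler_wpM2r //; lra.
lra.
Qed.
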